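(* Let $s\ge0$. Let $P(\partial_z)=\sum_{j\in\Lambda}a_j(z)\partial_z^j$ be a differential operator of order $p\in\mathbb{N}$, where $\Lambda\subset\mathbb{N}_0$ is finite and the coefficients $a_j$ are holomorphic on some neighborhood $D$ of the origin in $\mathbb{C}$. The operator $P(\partial_z)$ is a linear automorphism on $\mathbb{C}[[z]]$ which extends to an automorphism on $\mathbb{C}[[z]]_s$ if and only if the following conditions hold: (a) The lower ordinate $m$ of the Newton polygon $N(P)$ is equal to zero. (b) (non-resonance condition) $W_0(n)\neq0$ for every $n\in\mathbb{N}_0$, where $W_0$ is the characteristic polynomial of $P(\partial_z)$. (c) The first positive slope of the Newton polygon $N(P)$ is greater than or equal to $k=1/s$.
   Context: $\mathbb{N}=\{1,2,\dots\}$, $\mathbb{N}_0=\mathbb{N}\cup\{0\}$. $\mathbb{C}[[z]]_s$ is the space of Gevrey series of order $s$: all $\sum_{n\ge0}\varphi_nz^n\in\mathbb{C}[[z]]$ for which there are $C,A>0$ with $|\varphi_n|\le CA^n\Gamma(1+sn)$ for all $n\ge0$. ''A linear automorphism on $\mathbb{C}[[z]]$ extends to an automorphism on $\mathbb{C}[[z]]_s$'' means that its restriction to $\mathbb{C}[[z]]_s$ is a linear automorphism of $\mathbb{C}[[z]]_s$. The coefficients $a_j$, $j\in\Lambda$, are nonzero; $\alpha_j:=\mathrm{ord}_z(a_j)$ is the order of the zero of $a_j$ at $z=0$, and $a_j(z)=\sum_{k\ge\alpha_j}a_{j,k}z^k$. The operator acts on formal power series through formal differentiation. The Newton polygon is $N(P)=\mathrm{conv}\{\bigcup_{j\in\Lambda}Q(j,\alpha_j-j)\}$,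 where $Q(a,b)=\{(x,y)\in\mathbb{R}^2:x\le a,\ y\ge b\}$. Its lower ordinate is $m:=\min_{j\in\Lambda}(\alpha_j-j)\in\mathbb{Z}$. With $\Lambda_m:=\{j\in\Lambda:\alpha_j-j=m\}$, the characteristic polynomial of $P(\partial_z)$ is $$W_m(\lambda):=\sum_{j\in\Lambda_m}a_{j,j+m}\,\lambda(\lambda-1)\cdots(\lambda-j+1)$$ (empty product equal to $1$); it is denoted $W_0$ when $m=0$. The first positive slope of $N(P)$ is the smallest slope among the non-vertical boundary edges of $N(P)$ having positive slope; if there are none, it is taken to be $+\infty$. For $s=0$, $1/s:=+\infty$. *)

(* Defs.v *)
From Stdlib Require Import Reals ZArith List.
From Coquelicot Require Import Coquelicot.
Import ListNotations.

Open Scope R_scope.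

(** A formal power series over [C] is its sequence of coefficients. *)
Definition fps := nat -> C.

Definition fps_add (f g : fps) : fps :=
  PS_plus (K := C_AbsRing) (V := C_NormedModule) f g.

Definition fps_scal (x : C) (f : fps) : fps :=
  PS_scal (K := C_AbsRing) (V := C_NormedModule) x f.

Definition fps_mul (f g : fps) : fps :=
  fun n => sum_n (fun k => (f k * g (n - k)%nat)%C) n.

Definition fps_deriv (f : fps) : fps :=
  fun n => (RtoC (INR (S n)) * f (S n))%C.

Definition is_order (f : fps) (d : nat) : Prop :=
  f d <> 0%C /\ forall k, (k < d)%nat -> f k = 0%C.

Definition holomorphic_on (D : C -> Prop) (f : C -> C) : Prop :=
  forall z : C, D z -> ex_derive (K := C_AbsRing) (V := C_NormedModule) f z.

Definition is_taylor_at_0 (f : C -> C) (c : fps) : Prop :=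
  locally (RtoC 0)
    (fun z => is_pseries (K := C_AbsRing) (V := C_NormedModule) c z (f z)).

(** The operator [sum_(j in Lambda) c j * d^j/dz^j] on formal power series. *)
Definition diff_op (Lambda : list nat) (c : nat -> fps) (phi : fps) : fps :=
  fold_right fps_add (fun _ => 0%C)
    (map (fun j => fps_mul (c j) (Nat.iter j fps_deriv phi)) Lambda).

(** [T] restricts to a linear bijection of the subspace [V] onto itself. *)
Definition linear_automorphism_on (V : fps -> Prop) (T : fps -> fps) : Prop :=
  (forall f, V f -> V (T f)) /\
  (forall f g, V f -> V g -> T (fps_add f g) = fps_add (T f) (T g)) /\
  (forall (x : C) f, V f -> T (fps_scal x f) = fps_scal x (T f)) /\
  (forall f g, V f -> V g -> T f = T g -> f = g) /\
  (forall g, V g -> exists f, V f /\ T f = g).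

(** Euler's integral; meaningful for [0 < x]. *)
Definition Gamma (x : R) : R :=
  RInt_gen (fun t => Rpower t (x - 1) * exp (- t))
    (at_right 0) (Rbar_locally p_infty).

Definition gevrey (s : R) (phi : fps) : Prop :=
  exists M A : R, 0 < M /\ 0 < A /\
    forall n : nat, Cmod (phi n) <= M * A ^ n * Gamma (1 + s * INR n).

Definition convex_set (K : R * R -> Prop) : Prop :=
  forall (u v : R * R) (t : R), K u -> K v -> 0 <= t <= 1 ->
    K ((1 - t) * fst u + t * fst v, (1 - t) * snd u + t * snd v).

Definition convex_hull (S : R * R -> Prop) (q : R * R) : Prop :=
  forall K, convex_set K -> (forall u, S u -> K u) -> K q.

Definition quadrant (a b : R) (q : R * R) : Prop := fst q <= a /\ b <= snd q.

Definition ordinate (alpha : nat -> nat) (j : nat) : Z :=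
  (Z.of_nat (alpha j) - Z.of_nat j)%Z.

Definition newton_polygon (Lambda : list nat) (alpha : nat -> nat) :
    R * R -> Prop :=
  convex_hull (fun q => exists j, In j Lambda /\
    quadrant (INR j) (IZR (ordinate alpha j)) q).

(** The value [0] for the empty list is a dummy. *)
Definition lower_ordinate (Lambda : list nat) (alpha : nat -> nat) : Z :=
  match map (ordinate alpha) Lambda with
  | [] => 0%Z
  | x :: l => fold_right Z.min x l
  end.

(** An edge of a convex set is a face, cut out by a supporting line
    [u * x + v * y = w], that contains at least two points. *)
Definition is_edge (N E : R * R -> Prop) : Prop :=
  (exists u v w : R, (u <> 0 \/ v <> 0) /\
     (forall q, N q -> w <= u * fst q + v * snd q) /\
     (forall q, E q <-> N q /\ u * fst q + v * snd q = w)) /\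
  (exists q1 q2, E q1 /\ E q2 /\ q1 <> q2).

(** Only a non-vertical edge has a slope. *)
Definition edge_slope (E : R * R -> Prop) (sigma : R) : Prop :=
  exists q1 q2, E q1 /\ E q2 /\ fst q1 <> fst q2 /\
    sigma = (snd q2 - snd q1) / (fst q2 - fst q1).

(** A Newton polygon has finitely many edges, so this infimum is a minimum
    unless no edge has positive slope, in which case it is [p_infty]. *)
Definition first_positive_slope (N : R * R -> Prop) : Rbar :=
  Glb_Rbar (fun sigma =>
    0 < sigma /\ exists E, is_edge N E /\ edge_slope E sigma).

(** [lambda (lambda - 1) ... (lambda - j + 1)] *)
Definition falling (lambda : C) (j : nat) : C :=
  fold_right Cmult 1%C
    (map (fun i => (lambda - RtoC (INR i))%C) (seq 0 j)).

Definition char_poly (Lambda : list nat) (c : nat -> fps)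
    (alpha : nat -> nat) (m : Z) (lambda : C) : C :=
  fold_right Cplus 0%C
    (map (fun j => (c j (Z.to_nat (Z.of_nat j + m)) * falling lambda j)%C)
       (filter (fun j => Z.eqb (ordinate alpha j) m) Lambda)).

Definition inv_Rbar (s : R) : Rbar :=
  if Req_EM_T s 0 then p_infty else Finite (/ s).

(* Main.v *)
(** Write [P f = g] as an infinite linear system with matrix [T n l]. Then [T n l = 0]
    for [n - l < m], and [T (l + m) l = W_m l].  If [m > 0] the constant term of [P f]
    vanishes; if [m < 0] the kernel is nontrivial since [W_m l <> 0] for large [l]; if [m = 0]
    the system is triangular with diagonal [W_0], so [P] is bijective exactly under
    non-resonance.

    With [J] the largest [j] such that [alpha j = j], condition (c) says
    [j - J <= s (alpha j - j)] for all [j].  Gevrey growth is growth [M A^n n!^s], and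
    [|W_0 n| >= kappa (n + 1)^J]; under (c) one gets
    [|T n l| l!^s <= K B^(n - l) |W_0 n| n!^s], and the triangular recursion yields
    Gevrey solutions by a discrete Gronwall argument.

    If (c) fails, then for some [t > s] the maximum of [j - t (alpha j - j)] is attained
    at a single [j1], with [d1 = alpha j1 - j1 >= 1].  For weights [A^n n!^t], which
    dominate every Gevrey series of order [s], row [n] of the system is
    eventually dominated by its entry of index [n - d1]: a solution of the rows
    [n >= N] is determined by its first [N - d1] coefficients.  Hence [P] cannot
    reach all of [1, z, ..., z^(N-1)], an index [-d1] obstruction to surjectivity. *)
Require Import Defs.
From Stdlib Require Import Reals ZArith List Lra Lia.
From Stdlib Require Import FunctionalExtensionality Classical ClassicalEpsilon.
From Coquelicot Require Import Coquelicot.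
Import ListNotations.

Open Scope R_scope.

(** * Finite sums *)

(** For [m = 0] the polygon lies in the upper half-plane and its horizontal part ends at [(J, 0)],
    where the first edge of positive slope, if any, starts. Slope at least 1/s therefore means
    [x - J <= s y] at every corner. On the matrix this is a balance: the term of order j exceeds W_0
    by the power n^(j - J), it shifts indices by at least alpha j - j, and each unit of shift is
    worth n^s.

    The obstacle in the converse is that at t = s several j may tie in this balance, so that no
    entry prevails. Moving t slightly above s breaks the ties, and the spare factor n!^(t - s)
    absorbs every geometric rate, so that one fixed base A serves all Gevrey series of order s. This
    base is 2B, where the Taylor coefficients are O(B^k): the bound B^(n - l) on the entries grows
    to the left, and the weights (2B)^l outweigh it, so that each row concentrates at its largest
    index. The dominated rows still contain unknowns of index above n - d1, hence give no recursion;
    uniqueness comes from a contraction that halves a weighted bound again and again. *)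

Definition csum {I : Type} (f : I -> C) (l : list I) : C :=
  fold_right Cplus 0%C (map f l).

Definition rsum {I : Type} (f : I -> R) (l : list I) : R :=
  fold_right Rplus 0 (map f l).

Section FiniteSums.
Context {I : Type}.
Implicit Types (l : list I).

Lemma csum_cons (f : I -> C) x l : csum f (x :: l) = (f x + csum f l)%C.
Proof. reflexivity. Qed.

Lemma rsum_cons (f : I -> R) x l : rsum f (x :: l) = f x + rsum f l.
Proof. reflexivity. Qed.

Lemma csum_app (f : I -> C) l1 l2 :
  csum f (l1 ++ l2) = (csum f l1 + csum f l2)%C.
Proof.
  induction l1 as [|x l1 IH]; simpl; rewrite ?csum_cons, ?IH.
  - unfold csum at 2; simpl; ring.
  - ring.
Qed.

Lemma rsum_app (f : I -> R) l1 l2 : rsum f (l1 ++ l2) = rsum f l1 + rsum f l2.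
Proof.
  induction l1 as [|x l1 IH]; simpl; rewrite ?rsum_cons, ?IH.
  - unfold rsum at 2; simpl; ring.
  - ring.
Qed.

Lemma csum_ext (f g : I -> C) l :
  (forall x, In x l -> f x = g x) -> csum f l = csum g l.
Proof. intros H; unfold csum; f_equal; now apply map_ext_in. Qed.

Lemma csum_0 (f : I -> C) l : (forall x, In x l -> f x = 0%C) -> csum f l = 0%C.
Proof.
  induction l as [|x l IH]; intros H; [reflexivity|].
  rewrite csum_cons, H, IH; [ring| |now left].
  intros y Hy; apply H; now right.
Qed.

Lemma csum_plus (f g : I -> C) l :
  csum (fun x => (f x + g x)%C) l = (csum f l + csum g l)%C.
Proof.
  induction l as [|x l IH]; [unfold csum; simpl; ring|].
  rewrite !csum_cons, IH; ring.
Qed.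

Lemma csum_mult_l (a : C) (f : I -> C) l :
  csum (fun x => (a * f x)%C) l = (a * csum f l)%C.
Proof.
  induction l as [|x l IH]; [unfold csum; simpl; ring|].
  rewrite !csum_cons, IH; ring.
Qed.

Lemma csum_mult_r (a : C) (f : I -> C) l :
  csum (fun x => (f x * a)%C) l = (csum f l * a)%C.
Proof.
  induction l as [|x l IH]; [unfold csum; simpl; ring|].
  rewrite !csum_cons, IH; ring.
Qed.

Lemma csum_filter (b : I -> bool) (f : I -> C) l :
  csum f (filter b l) = csum (fun x => if b x then f x else 0%C) l.
Proof.
  induction l as [|x l IH]; [reflexivity|].
  simpl; destruct (b x) eqn:E; rewrite !csum_cons, E, IH; [reflexivity|ring].
Qed.

Lemma rsum_le (f g : I -> R) l :
  (forall x, In x l -> f x <= g x) -> rsum f l <= rsum g l.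
Proof.
  induction l as [|x l IH]; intros H; [apply Rle_refl|].
  rewrite !rsum_cons; apply Rplus_le_compat; [apply H; now left|].
  apply IH; intros y Hy; apply H; now right.
Qed.

Lemma rsum_mult_l (a : R) (f : I -> R) l :
  rsum (fun x => a * f x) l = a * rsum f l.
Proof.
  induction l as [|x l IH]; [unfold rsum; simpl; ring|].
  rewrite !rsum_cons, IH; ring.
Qed.

Lemma rsum_const (a : R) l : rsum (fun _ => a) l = INR (length l) * a.
Proof.
  induction l as [|x l IH]; [unfold rsum; simpl; ring|].
  rewrite rsum_cons, IH; simpl length; rewrite S_INR; ring.
Qed.

Lemma rsum_nonneg (f : I -> R) l :
  (forall x, In x l -> 0 <= f x) -> 0 <= rsum f l.
Proof.
  intros H; rewrite <- (Rmult_0_r (INR (length l))), <- rsum_const.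
  now apply rsum_le.
Qed.

Lemma Cmod_csum_le (f : I -> C) l : Cmod (csum f l) <= rsum (fun x => Cmod (f x)) l.
Proof.
  induction l as [|x l IH]; [unfold csum; simpl; rewrite Cmod_0; apply Rle_refl|].
  rewrite csum_cons, rsum_cons.
  eapply Rle_trans; [apply Cmod_triangle|]; lra.
Qed.

End FiniteSums.

Lemma csum_map {I J : Type} (g : I -> J) (f : J -> C) l :
  csum f (map g l) = csum (fun x => f (g x)) l.
Proof. unfold csum; now rewrite map_map. Qed.

Lemma csum_swap {I J : Type} (f : I -> J -> C) l1 l2 :
  csum (fun x => csum (f x) l2) l1 = csum (fun y => csum (fun x => f x y) l1) l2.
Proof.
  induction l1 as [|x l1 IH].
  - symmetry; now apply csum_0.
  - rewrite csum_cons, IH, <- csum_plus; reflexivity.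
Qed.

Lemma csum_seq_S (f : nat -> C) n :
  csum f (seq 0 (S n)) = (csum f (seq 0 n) + f n)%C.
Proof.
  rewrite seq_S, csum_app, csum_cons; unfold csum at 2; simpl; ring.
Qed.

Lemma rsum_seq_S (f : nat -> R) n :
  rsum f (seq 0 (S n)) = rsum f (seq 0 n) + f n.
Proof.
  rewrite seq_S, rsum_app, rsum_cons; unfold rsum at 2; simpl; ring.
Qed.

Lemma csum_delta (f : nat -> C) l k :
  NoDup l -> In k l ->
  csum f l = (f k + csum (fun x => if Nat.eqb x k then 0 else f x) l)%C.
Proof.
  intros Hl Hk; destruct (in_split _ _ Hk) as (l1 & l2 & ->).
  apply NoDup_remove_2 in Hl.
  rewrite !csum_app, !csum_cons, Nat.eqb_refl.
  rewrite (csum_ext f (fun x => if Nat.eqb x k then 0%C else f x) l1),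
    (csum_ext f (fun x => if Nat.eqb x k then 0%C else f x) l2); [ring| |];
    intros x Hx; destruct (Nat.eqb_spec x k) as [->|]; trivial;
    exfalso; apply Hl, in_or_app; tauto.
Qed.

Lemma csum_seq_truncate (f : nat -> C) n m :
  (n <= m)%nat -> (forall k, (n <= k < m)%nat -> f k = 0%C) ->
  csum f (seq 0 m) = csum f (seq 0 n).
Proof.
  intros Hnm Hf; induction m as [|m IH].
  - now replace n with 0%nat by lia.
  - destruct (Nat.eq_dec n (S m)) as [->|Hne]; trivial.
    rewrite csum_seq_S, Hf, IH; [ring| | |]; try lia.
    intros; apply Hf; lia.
Qed.

Lemma sum_n_csum (f : nat -> C) n : sum_n f n = csum f (seq 0 (S n)).
Proof.
  induction n as [|n IH].
  - rewrite sum_O, csum_seq_S; unfold csum; simpl; ring.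
  - rewrite sum_Sn, IH, (csum_seq_S f (S n)); reflexivity.
Qed.

Lemma csum_seq_rev (f : nat -> C) n :
  csum f (seq 0 (S n)) = csum (fun k => f (n - k)%nat) (seq 0 (S n)).
Proof.
  induction n as [|n IH]; [reflexivity|].
  rewrite csum_seq_S, IH.
  rewrite <- (cons_seq (S n) 0), <- seq_shift, csum_cons, csum_map, Nat.sub_0_r.
  rewrite Cplus_comm; reflexivity.
Qed.

(** * Falling factorials *)

Lemma falling_S (x : C) j :
  falling x (S j) = (falling x j * (x - RtoC (INR j)))%C.
Proof.
  unfold falling; rewrite seq_S, map_app, fold_right_app; simpl.
  generalize (map (fun i => (x - RtoC (INR i))%C) (seq 0 j)) as l.
  induction l as [|y l IH]; simpl; [ring|rewrite IH; ring].
Qed.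

Lemma falling_small l j : (l < j)%nat -> falling (RtoC (INR l)) j = 0%C.
Proof.
  induction j as [|j IH]; intros H; [lia|].
  rewrite falling_S; destruct (Nat.eq_dec l j) as [->|Hne].
  - ring.
  - rewrite IH by lia; ring.
Qed.

(** For [l < j] the product vanishes, which disposes of the factors [l - i] with [i > l]: their
    moduli may exceed [l]. *)
Lemma Cmod_falling_le l j : Cmod (falling (RtoC (INR l)) j) <= INR l ^ j.
Proof.
  induction j as [|j IH].
  - unfold falling; simpl; rewrite Cmod_1; apply Rle_refl.
  - destruct (le_lt_dec l j) as [Hle|Hlt].
    + rewrite falling_small by lia; rewrite Cmod_0; apply pow_le, pos_INR.
    + rewrite falling_S, Cmod_mult, <- RtoC_minus, Cmod_R; simpl.
      rewrite Rmult_comm; apply Rmult_le_compat; trivial using Cmod_ge_0, Rabs_pos.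
      pose proof (pos_INR j); pose proof (lt_INR _ _ Hlt).
      rewrite Rabs_pos_eq; lra.
Qed.

(** Every factor [l - i] with [i < j] is at least [l / 2]. *)
Lemma Cmod_falling_ge l j :
  (2 * j <= l)%nat -> (INR l / 2) ^ j <= Cmod (falling (RtoC (INR l)) j).
Proof.
  induction j as [|j IH]; intros H.
  - unfold falling; simpl; rewrite Cmod_1; apply Rle_refl.
  - rewrite falling_S, Cmod_mult, <- RtoC_minus, Cmod_R; simpl.
    rewrite Rmult_comm.
    assert (Hj : 2 * INR j <= INR l)
      by (change 2 with (INR 2); rewrite <- mult_INR; apply le_INR; lia).
    pose proof (pos_INR j); pose proof (pos_INR l).
    apply Rmult_le_compat; [apply pow_le; lra | lra | apply IH; lia |].
    rewrite Rabs_pos_eq; lra.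
Qed.

Lemma iter_fps_deriv (phi : fps) j i :
  Nat.iter j fps_deriv phi i =
  (falling (RtoC (INR (i + j))) j * phi (i + j)%nat)%C.
Proof.
  revert i; induction j as [|j IH]; intros i.
  - simpl; rewrite Nat.add_0_r; unfold falling; simpl; ring.
  - change (Nat.iter (S j) fps_deriv phi i)
      with (RtoC (INR (S i)) * Nat.iter j fps_deriv phi (S i))%C.
    rewrite IH, Nat.add_succ_r, falling_S, Nat.add_succ_l.
    replace (RtoC (INR (S (i + j))) - RtoC (INR j))%C with (RtoC (INR (S i)));
      [ring|].
    rewrite <- RtoC_minus, !S_INR, plus_INR; f_equal; ring.
Qed.

(** * The matrix of the operator *)

(** The coefficient of z^n in [c j] times the [j]-th derivative of z^l. The guard excludes negative
    Taylor indices, where truncated subtraction would wrongly give the index 0. *)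
Definition entry (c : nat -> fps) (j n l : nat) : C :=
  ((if (l <=? n + j)%nat then c j (n + j - l)%nat else 0)
   * falling (RtoC (INR l)) j)%C.

Definition op_matrix (Lambda : list nat) (c : nat -> fps) (n l : nat) : C :=
  csum (fun j => entry c j n l) Lambda.

Lemma fps_mul_deriv_entry (c : nat -> fps) j (phi : fps) n :
  fps_mul (c j) (Nat.iter j fps_deriv phi) n =
  csum (fun l => (entry c j n l * phi l)%C) (seq 0 (S (n + j))).
Proof.
  unfold fps_mul; rewrite sum_n_csum, csum_seq_rev.
  replace (S (n + j)) with (j + S n)%nat by lia.
  (* The indices [l < j] are killed by the falling factorial, so the sum may start at 0 for every
     [j]. *)
  rewrite seq_app, csum_app, (csum_0 _ (seq 0 j)).
  2: { intros l Hl; apply in_seq in Hl; unfold entry.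
       rewrite falling_small by lia; ring. }
  rewrite Nat.add_0_l, Cplus_0_l.
  replace (seq j (S n)) with (map (fun i => i + j)%nat (seq 0 (S n))).
  - rewrite csum_map; apply csum_ext; intros i Hi; apply in_seq in Hi.
    rewrite iter_fps_deriv; unfold entry.
    replace (n - (n - i))%nat with i by lia.
    destruct (Nat.leb_spec (i + j) (n + j)) as [_|]; [|lia].
    replace (n + j - (i + j))%nat with (n - i)%nat by lia; ring.
  - clear; generalize (S n) as m; intros m.
    replace (seq j m) with (seq (0 + j) m) by reflexivity.
    generalize 0%nat as a; induction m as [|m IH]; intros a; simpl; trivial.
    f_equal; apply IH.
Qed.

Lemma diff_op_csum Lambda c phi n :
  diff_op Lambda c phi n =
  csum (fun j => fps_mul (c j) (Nat.iter j fps_deriv phi) n) Lambda.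
Proof.
  induction Lambda as [|j L IH]; [reflexivity|].
  rewrite csum_cons, <- IH; reflexivity.
Qed.

(** Padding with zero entries up to [n + p] replaces the range up to [n + j], which depends on [j],
    by a common one; the sums over [j] and [l] can then be exchanged. *)
Lemma diff_op_matrix Lambda c phi p n :
  (forall j, In j Lambda -> (j <= p)%nat) ->
  diff_op Lambda c phi n =
  csum (fun l => (op_matrix Lambda c n l * phi l)%C) (seq 0 (S (n + p))).
Proof.
  intros Hp; rewrite diff_op_csum.
  rewrite (csum_ext _ (fun l => csum (fun j => entry c j n l * phi l)%C Lambda)
             (seq 0 (S (n + p)))).
  2: { intros l _; symmetry; apply csum_mult_r. }
  rewrite csum_swap; apply csum_ext; intros j Hj.
  rewrite fps_mul_deriv_entry; symmetry; apply csum_seq_truncate.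
  - specialize (Hp j Hj); lia.
  - intros k Hk; unfold entry.
    destruct (Nat.leb_spec k (n + j)) as [|_]; [lia|ring].
Qed.

Lemma diff_op_combination Lambda c p (x : C) (f g : fps) :
  (forall j, In j Lambda -> (j <= p)%nat) ->
  diff_op Lambda c (fun n => (f n + x * g n)%C) =
  (fun n => diff_op Lambda c f n + x * diff_op Lambda c g n)%C.
Proof.
  intros Hp; apply functional_extensionality; intros n.
  rewrite !(diff_op_matrix _ _ _ p) by trivial.
  rewrite <- csum_mult_l, <- csum_plus; apply csum_ext; intros; ring.
Qed.

Lemma diff_op_add Lambda c p (f g : fps) :
  (forall j, In j Lambda -> (j <= p)%nat) ->
  diff_op Lambda c (fps_add f g) = fps_add (diff_op Lambda c f) (diff_op Lambda c g).
Proof.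
  intros Hp.
  replace (fps_add f g) with (fun n => f n + 1 * g n)%C.
  - rewrite (diff_op_combination _ _ p) by trivial.
    apply functional_extensionality; intros n.
    change (fps_add ?u ?v n) with (u n + v n)%C; ring.
  - apply functional_extensionality; intros n.
    change (fps_add ?u ?v n) with (u n + v n)%C; ring.
Qed.

Lemma diff_op_0 Lambda c p :
  (forall j, In j Lambda -> (j <= p)%nat) ->
  diff_op Lambda c (fun _ => 0%C) = (fun _ => 0%C).
Proof.
  intros Hp; apply functional_extensionality; intros n.
  rewrite (diff_op_matrix _ _ _ p) by trivial.
  apply csum_0; intros; ring.
Qed.

Lemma diff_op_scal Lambda c p (x : C) (f : fps) :
  (forall j, In j Lambda -> (j <= p)%nat) ->
  diff_op Lambda c (fps_scal x f) = fps_scal x (diff_op Lambda c f).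
Proof.
  intros Hp.
  replace (fps_scal x f) with (fun n => 0 + x * f n)%C.
  - rewrite (diff_op_combination Lambda c p x (fun _ => 0%C) f Hp),
      (diff_op_0 _ _ p) by trivial.
    apply functional_extensionality; intros n.
    change (fps_scal ?u ?v n) with (u * v n)%C; ring.
  - apply functional_extensionality; intros n.
    change (fps_scal ?u ?v n) with (u * v n)%C; ring.
Qed.

(** * Underdetermined systems and recursive sequences *)

(* Induction on the number of unknowns, the last one being the pivot. *)
Lemma underdetermined_system (rows : list (nat -> C)) (M : nat) :
  (length rows < M)%nat ->
  exists x : nat -> C,
    (exists k, (k < M)%nat /\ x k <> 0%C) /\
    forall r, In r rows -> csum (fun k => (r k * x k)%C) (seq 0 M) = 0%C.
Proof.
  revert rows; induction M as [|M IH]; intros rows Hlen; [lia|].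
  destruct (classic (forall r, In r rows -> r M = 0%C)) as [Hz|Hnz].
  - exists (fun k => if Nat.eqb k M then 1%C else 0%C); split.
    + exists M; split; [lia|]; rewrite Nat.eqb_refl; apply C1_nz.
    + intros r Hr; rewrite csum_seq_S, Nat.eqb_refl, (Hz r Hr), csum_0; [ring|].
      intros k Hk; apply in_seq in Hk.
      destruct (Nat.eqb_spec k M); [lia|ring].
  - apply not_all_ex_not in Hnz as [r0 Hr0]; apply imply_to_and in Hr0 as [Hin Hr0].
    destruct (in_split _ _ Hin) as (l1 & l2 & ->).
    (* Gaussian elimination: subtracting a multiple of the pivot row [r0] cancels the coefficient of
       index [M]. Afterwards [r0] itself is solved for the last unknown. *)
    set (red := fun (r : nat -> C) (k : nat) => (r k - r M / r0 M * r0 k)%C).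
    destruct (IH (map red (l1 ++ l2))) as (x & (k & Hk & Hxk) & Hx).
    { rewrite length_map; rewrite length_app in *; simpl in Hlen; lia. }
    set (t := (- csum (fun k => r0 k * x k) (seq 0 M) / r0 M)%C).
    assert (Hsum : forall r : nat -> C,
      csum (fun k => (r k * (if Nat.eqb k M then t else x k))%C) (seq 0 (S M)) =
      (csum (fun k => red r k * x k) (seq 0 M))%C).
    { intros r; rewrite csum_seq_S, Nat.eqb_refl.
      rewrite (csum_ext _ (fun k => r k * x k)%C).
      2: { intros i Hi; apply in_seq in Hi.
           destruct (Nat.eqb_spec i M); [lia|reflexivity]. }
      rewrite (csum_ext (fun k => red r k * x k)%C
                 (fun k => r k * x k + (- (r M / r0 M)) * (r0 k * x k))%C)
        by (intros; unfold red; ring).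
      rewrite csum_plus, csum_mult_l; unfold t; field; trivial. }
    exists (fun k => if Nat.eqb k M then t else x k); split.
    + exists k; split; [lia|]; destruct (Nat.eqb_spec k M); [lia|trivial].
    + intros r Hr; rewrite Hsum.
      apply in_app_or in Hr; simpl in Hr.
      destruct Hr as [Hr|[<-|Hr]].
      * apply Hx, in_map, in_or_app; now left.
      * apply csum_0; intros; unfold red; field; trivial.
      * apply Hx, in_map, in_or_app; now right.
Qed.

(** In the proof [u n] is correct at the indices below [n], and later stages never change these
    values. Its other values are junk, which [F n] ignores by hypothesis. The solution is the
    diagonal [u (S n) n]. *)
Lemma strong_recursion (F : nat -> (nat -> C) -> C) :
  (forall n f g, (forall k, (k < n)%nat -> f k = g k) -> F n f = F n g) ->
  exists phi : nat -> C, forall n, phi n = F n phi.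
Proof.
  intros HF.
  set (u := nat_rect (fun _ => nat -> C) (fun _ => 0%C)
    (fun n f k => if (k <? n)%nat then f k else F n f)).
  assert (Hu : forall d n, u (S (n + d))%nat n = F n (u n)).
  { induction d as [|d IH]; intros n.
    - rewrite Nat.add_0_r; simpl.
      destruct (Nat.ltb_spec n n); [lia|reflexivity].
    - rewrite <- IH, Nat.add_succ_r; simpl.
      destruct (Nat.ltb_spec n (S (n + d))); [reflexivity|lia]. }
  exists (fun n => u (S n) n); intros n.
  pose proof (Hu 0%nat n) as H0; rewrite Nat.add_0_r in H0; rewrite H0.
  apply HF; intros k Hk.
  replace n with (S (k + (n - S k))) at 1 by lia.
  rewrite Hu; pose proof (Hu 0%nat k) as H1; rewrite Nat.add_0_r in H1.
  now rewrite H1.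
Qed.

(** * Automorphisms of the space of all formal power series *)

Lemma fold_right_Zmin_le (x : Z) l y :
  In y (x :: l) -> (fold_right Z.min x l <= y)%Z.
Proof.
  induction l as [|z l IH]; simpl.
  - intros [->|[]]; lia.
  - intros [->|[->|Hy]]; [|lia|].
    + assert (fold_right Z.min y l <= y)%Z by (apply IH; now left); lia.
    + assert (fold_right Z.min x l <= y)%Z by (apply IH; now right); lia.
Qed.

Lemma fold_right_Zmin_in (x : Z) l : In (fold_right Z.min x l) (x :: l).
Proof.
  induction l as [|z l IH]; simpl; [now left|].
  destruct (Z.min_spec z (fold_right Z.min x l)) as [[_ ->]|[_ ->]]; [tauto|].
  destruct IH as [<-|H]; [now left|tauto].
Qed.

Lemma lower_ordinate_le Lambda alpha j :
  In j Lambda -> (lower_ordinate Lambda alpha <= ordinate alpha j)%Z.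
Proof.
  intros Hj; unfold lower_ordinate.
  apply (in_map (ordinate alpha)) in Hj.
  destruct (map (ordinate alpha) Lambda); [destruct Hj|].
  now apply fold_right_Zmin_le.
Qed.

Lemma lower_ordinate_attained Lambda alpha j0 :
  In j0 Lambda ->
  exists j, In j Lambda /\ ordinate alpha j = lower_ordinate Lambda alpha.
Proof.
  intros Hj; unfold lower_ordinate.
  apply (in_map (ordinate alpha)) in Hj.
  destruct (map (ordinate alpha) Lambda) as [|x l] eqn:E; [destruct Hj|].
  pose proof (fold_right_Zmin_in x l) as H; rewrite <- E in H.
  apply in_map_iff in H as (j & Hj1 & Hj2); now exists j.
Qed.

Lemma bounded_nat_max (P : nat -> Prop) (p : nat) :
  (exists j, P j) -> (forall j, P j -> (j <= p)%nat) ->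
  exists J, P J /\ forall j, P j -> (j <= J)%nat.
Proof.
  induction p as [|p IH]; intros [j Hj] Hp.
  - exists j; split; trivial; intros i Hi; specialize (Hp i Hi); lia.
  - destruct (classic (P (S p))) as [H|H]; [now exists (S p)|].
    apply IH; [now exists j|]; intros i Hi.
    destruct (Nat.eq_dec i (S p)) as [->|]; [contradiction|].
    specialize (Hp i Hi); lia.
Qed.

Section FormalOperator.

Context (p : nat) (Lambda : list nat) (c : nat -> fps) (alpha : nat -> nat).
Hypothesis hLambda : NoDup Lambda.
Hypothesis hpLambda : In p Lambda.
Hypothesis hmax : forall j, In j Lambda -> (j <= p)%nat.
Hypothesis halpha : forall j, In j Lambda -> is_order (c j) (alpha j).

Let m := lower_ordinate Lambda alpha.

Lemma entry_0 j n l :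
  In j Lambda -> (n + j < l + alpha j)%nat -> entry c j n l = 0%C.
Proof.
  intros Hj H; unfold entry; destruct (Nat.leb_spec l (n + j)); [|ring].
  rewrite (proj2 (halpha j Hj)) by lia; ring.
Qed.

Lemma op_matrix_0 n l :
  (Z.of_nat n < Z.of_nat l + m)%Z -> op_matrix Lambda c n l = 0%C.
Proof.
  intros H; apply csum_0; intros j Hj; apply entry_0; trivial.
  pose proof (lower_ordinate_le Lambda alpha j Hj); unfold ordinate in *.
  unfold m in H; lia.
Qed.

Lemma op_matrix_diag n l :
  Z.of_nat n = (Z.of_nat l + m)%Z ->
  op_matrix Lambda c n l = char_poly Lambda c alpha m (RtoC (INR l)).
Proof.
  intros H.
  unfold char_poly; fold (csum (fun j => (c j (Z.to_nat (Z.of_nat j + m))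
    * falling (RtoC (INR l)) j)%C)
    (filter (fun j => Z.eqb (ordinate alpha j) m) Lambda)).
  rewrite csum_filter; apply csum_ext; intros j Hj.
  pose proof (lower_ordinate_le Lambda alpha j Hj) as Hm; fold m in Hm.
  destruct (Z.eqb_spec (ordinate alpha j) m) as [E|E].
  - unfold entry, ordinate in *.
    destruct (Nat.leb_spec l (n + j)); [|lia].
    do 2 f_equal; lia.
  - apply entry_0; trivial; unfold ordinate in *; lia.
Qed.

(** The falling factorial of degree [J] carries the leading Taylor coefficient of [c J], which is
    nonzero, and every other term of the polynomial has smaller degree. *)
Lemma char_poly_lower_bound J :
  In J Lambda -> ordinate alpha J = m ->
  (forall j, In j Lambda -> ordinate alpha j = m -> (j <= J)%nat) ->
  exists kappa, 0 < kappa /\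
    eventually (fun n =>
      kappa * INR n ^ J <= Cmod (char_poly Lambda c alpha m (RtoC (INR n)))).
Proof.
  intros HJ HJm HJmax.
  set (b := fun j => c j (Z.to_nat (Z.of_nat j + m))).
  assert (Hb : 0 < Cmod (b J)).
  { apply Cmod_gt_0; unfold b; replace (Z.to_nat _) with (alpha J).
    - apply halpha, HJ.
    - unfold ordinate in HJm; lia. }
  set (S0 := rsum (fun j => Cmod (b j)) Lambda).
  assert (HS0 : 0 <= S0) by (apply rsum_nonneg; intros; apply Cmod_ge_0).
  (* The part [(/ 2) ^ J] is the loss in [Cmod_falling_ge]; the remaining 1/2 is what the terms of
     lower degree may consume. *)
  exists (Cmod (b J) * (/ 2) ^ (S J)); split.
  { apply Rmult_lt_0_compat; trivial; apply pow_lt; lra. }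
  destruct (INR_unbounded (S0 / (Cmod (b J) * (/ 2) ^ (S J)))) as [N HN].
  exists (N + 2 * J + 1)%nat; intros n Hn.
  assert (Hn1 : INR N <= INR n) by (apply le_INR; lia).
  assert (Hn0 : 1 <= INR n) by (apply (le_INR 1); lia).
  unfold char_poly; fold (csum (fun j => (c j (Z.to_nat (Z.of_nat j + m))
    * falling (RtoC (INR n)) j)%C)
    (filter (fun j => Z.eqb (ordinate alpha j) m) Lambda)).
  rewrite csum_filter, (csum_delta _ Lambda J) by trivial.
  destruct (Z.eqb_spec (ordinate alpha J) m) as [_|]; [|contradiction].
  fold (b J); set (rest := csum _ _).
  (* The factor [INR n] on the left avoids the exponent [J - 1], which truncated subtraction would
     spoil for [J = 0]. *)
  assert (Hrest : Cmod rest * INR n <= S0 * INR n ^ J).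
  { unfold rest; rewrite Rmult_comm.
    eapply Rle_trans;
      [apply Rmult_le_compat_l; [apply pos_INR | apply Cmod_csum_le]|].
    rewrite <- rsum_mult_l, (Rmult_comm S0); unfold S0; rewrite <- rsum_mult_l.
    apply rsum_le; intros j Hj.
    assert (0 <= INR n ^ J * Cmod (b j))
      by (apply Rmult_le_pos; [apply pow_le; lra | apply Cmod_ge_0]).
    destruct (Nat.eqb_spec j J) as [->|HjJ]; [rewrite Cmod_0; lra|].
    destruct (Z.eqb_spec (ordinate alpha j) m) as [E|E]; [|rewrite Cmod_0; lra].
    specialize (HJmax j Hj E); fold (b j); rewrite Cmod_mult.
    rewrite (Rmult_comm (INR n ^ J)), (Rmult_comm (INR n)), Rmult_assoc.
    apply Rmult_le_compat_l; [apply Cmod_ge_0|].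
    replace J with (J - S j + S j)%nat by lia; rewrite pow_add.
    rewrite <- (Rmult_1_l (_ * INR n)).
    apply Rmult_le_compat; [lra| | |].
    - apply Rmult_le_pos; [apply Cmod_ge_0 | lra].
    - apply pow_R1_Rle; lra.
    - simpl; rewrite Rmult_comm; apply Rmult_le_compat_l; [lra|].
      apply Cmod_falling_le. }
  assert (Hmain : Cmod (b J) * (INR n ^ J * (/ 2) ^ J) <=
                  Cmod (b J * falling (RtoC (INR n)) J)).
  { rewrite Cmod_mult, <- Rpow_mult_distr.
    apply Rmult_le_compat_l; [apply Cmod_ge_0|].
    apply Cmod_falling_ge; lia. }
  pose proof (Cmod_triangle (b J * falling (RtoC (INR n)) J + rest) (- rest)) as Htri.
  rewrite Cmod_opp in Htri.
  replace (b J * falling (RtoC (INR n)) J + rest + - rest)%C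
    with (b J * falling (RtoC (INR n)) J)%C in Htri by ring.
  assert (Hsmall : Cmod rest <= Cmod (b J) * (/ 2) ^ S J * INR n ^ J).
  { apply Rmult_le_reg_r with (INR n); [lra|].
    eapply Rle_trans; [exact Hrest|].
    replace (Cmod (b J) * (/ 2) ^ S J * INR n ^ J * INR n)
      with ((Cmod (b J) * (/ 2) ^ S J * INR n) * INR n ^ J) by ring.
    apply Rmult_le_compat_r; [apply pow_le; lra|].
    assert (0 < Cmod (b J) * (/ 2) ^ S J)
      by (apply Rmult_lt_0_compat; trivial; apply pow_lt; lra).
    replace S0 with (Cmod (b J) * (/ 2) ^ S J * (S0 / (Cmod (b J) * (/ 2) ^ S J)))
      by (field; split; [apply pow_nonzero|]; lra).
    apply Rmult_le_compat_l; [now left|].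
    apply Rle_trans with (INR N); [now left | exact Hn1]. }
  simpl pow in Hsmall |- *; lra.
Qed.

Lemma char_poly_eventually_nonzero :
  eventually (fun n => char_poly Lambda c alpha m (RtoC (INR n)) <> 0%C).
Proof.
  destruct (bounded_nat_max (fun j => In j Lambda /\ ordinate alpha j = m) p)
    as (J & [HJ HJm] & HJmax).
  - apply (lower_ordinate_attained Lambda alpha p); trivial.
  - intros j [Hj _]; now apply hmax.
  - destruct (char_poly_lower_bound J HJ HJm) as (kappa & Hk & N & HN).
    { intros j H1 H2; now apply HJmax. }
    exists (S N); intros n Hn E.
    assert (HnN : (N <= n)%nat) by lia.
    specialize (HN n HnN); rewrite E, Cmod_0 in HN.
    assert (0 < kappa * INR n ^ J); [|lra].
    apply Rmult_lt_0_compat; trivial; apply pow_lt, lt_0_INR; lia.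
Qed.

(* For [n >= N] row [n] determines the coefficient of index [n + mu] from the
   previous ones, which leaves [N] equations in the first [N + mu] coefficients. *)
Lemma kernel_of_negative_lower_ordinate :
  (m < 0)%Z ->
  exists phi : fps, diff_op Lambda c phi = (fun _ => 0%C) /\ phi <> (fun _ => 0%C).
Proof.
  intros Hm; destruct char_poly_eventually_nonzero as [N HN].
  set (mu := Z.to_nat (- m)).
  destruct (underdetermined_system (map (op_matrix Lambda c) (seq 0 N)) (N + mu))
    as (x & (k0 & Hk0 & Hx0) & Hx).
  { rewrite length_map, length_seq; lia. }
  set (F := fun l (f : nat -> C) =>
    if (l <? N + mu)%nat then x l
    else (- csum (fun k => op_matrix Lambda c (l - mu) k * f k) (seq 0 l)
          / op_matrix Lambda c (l - mu) l)%C).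
  destruct (strong_recursion F) as [phi Hphi].
  { intros n f g Hfg; unfold F; destruct (n <? N + mu)%nat; trivial.
    do 2 f_equal; apply csum_ext; intros k Hk; apply in_seq in Hk.
    rewrite Hfg by lia; reflexivity. }
  assert (Hlow : forall l, (l < N + mu)%nat -> phi l = x l).
  { intros l Hl; rewrite Hphi; unfold F.
    destruct (Nat.ltb_spec l (N + mu)); [reflexivity|lia]. }
  exists phi; split.
  - apply functional_extensionality; intros n.
    rewrite (diff_op_matrix _ _ _ p) by trivial.
    assert (Hcut : csum (fun l => (op_matrix Lambda c n l * phi l)%C)
                     (seq 0 (S (n + p))) =
                   csum (fun l => (op_matrix Lambda c n l * phi l)%C)
                     (seq 0 (S (n + mu)))).
    { destruct (le_lt_dec (S (n + p)) (S (n + mu))) as [Hle|Hlt].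
      - symmetry; apply csum_seq_truncate; trivial.
        intros k Hk; unfold op_matrix; rewrite csum_0; [ring|].
        intros j Hj; unfold entry; specialize (hmax j Hj).
        destruct (Nat.leb_spec k (n + j)); [lia|ring].
      - apply csum_seq_truncate; [lia|].
        intros k Hk; rewrite op_matrix_0 by lia; ring. }
    rewrite Hcut; destruct (le_lt_dec N n) as [Hn|Hn].
    + rewrite csum_seq_S, (Hphi (n + mu)%nat); unfold F at 1.
      destruct (Nat.ltb_spec (n + mu) (N + mu)); [lia|].
      replace (n + mu - mu)%nat with n by lia.
      field; rewrite op_matrix_diag by lia; apply HN; lia.
    (* A row [n < N] has no entry beyond [n + mu], so it may be extended to the full width [N + mu]
       of the finite system. *)
    + rewrite <- (csum_seq_truncate _ (S (n + mu)) (N + mu)); [|lia|].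
      * rewrite <- (Hx (op_matrix Lambda c n)).
        -- apply csum_ext; intros k Hk; apply in_seq in Hk.
           rewrite Hlow by lia; reflexivity.
        -- apply in_map, in_seq; lia.
      * intros k Hk; rewrite op_matrix_0 by lia; ring.
  - intros E; apply Hx0; rewrite <- Hlow, E by trivial; reflexivity.
Qed.

Lemma diff_op_triangular (phi : fps) n :
  m = 0%Z ->
  diff_op Lambda c phi n =
  (csum (fun l => op_matrix Lambda c n l * phi l) (seq 0 n)
   + char_poly Lambda c alpha m (RtoC (INR n)) * phi n)%C.
Proof.
  intros Hm; rewrite (diff_op_matrix _ _ _ p) by trivial.
  rewrite (csum_seq_truncate _ (S n)); [|lia|].
  - rewrite csum_seq_S, (op_matrix_diag n n) by lia; reflexivity.
  - intros k Hk; rewrite op_matrix_0 by lia; ring.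
Qed.

Lemma diff_op_injective :
  m = 0%Z ->
  (forall n, char_poly Lambda c alpha m (RtoC (INR n)) <> 0%C) ->
  forall f g, diff_op Lambda c f = diff_op Lambda c g -> f = g.
Proof.
  intros Hm HW f g E; apply functional_extensionality; intros n.
  induction n as [n IH] using lt_wf_ind.
  pose proof (equal_f E n) as En; rewrite !diff_op_triangular in En by trivial.
  rewrite (csum_ext _ (fun l => op_matrix Lambda c n l * g l)%C) in En.
  2: { intros l Hl; apply in_seq in Hl; rewrite IH by lia; reflexivity. }
  set (w := char_poly _ _ _ _ _) in *.
  assert (H : (w * (f n - g n))%C = 0%C).
  { set (s := csum _ _) in En.
    replace (w * (f n - g n))%C with ((s + w * f n) - (s + w * g n))%C by ring.
    rewrite En; ring. }
  apply Ceq_minus; destruct (classic ((f n - g n)%C = 0%C)) as [|Hne]; trivial.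
  exfalso; exact (Cmult_neq_0 _ _ (HW n) Hne H).
Qed.

Lemma diff_op_surjective :
  m = 0%Z ->
  (forall n, char_poly Lambda c alpha m (RtoC (INR n)) <> 0%C) ->
  forall g, exists f, diff_op Lambda c f = g.
Proof.
  intros Hm HW g.
  destruct (strong_recursion (fun n f =>
    ((g n - csum (fun k => op_matrix Lambda c n k * f k) (seq 0 n))
     / char_poly Lambda c alpha m (RtoC (INR n)))%C)) as [phi Hphi].
  { intros n f h Hfh; do 2 f_equal; apply csum_ext; intros k Hk.
    apply in_seq in Hk; rewrite Hfh by lia; reflexivity. }
  exists phi; apply functional_extensionality; intros n.
  rewrite diff_op_triangular, (Hphi n) by trivial; field; apply HW.
Qed.

Lemma formal_automorphism_iff :
  linear_automorphism_on (fun _ => True) (diff_op Lambda c) <->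
  m = 0%Z /\ forall n, char_poly Lambda c alpha m (RtoC (INR n)) <> 0%C.
Proof.
  split.
  - intros (_ & _ & _ & Hinj & Hsurj).
    assert (Hm : m = 0%Z).
    { destruct (Z.lt_trichotomy m 0) as [Hneg|[Hz|Hpos]]; trivial; exfalso.
      - destruct (kernel_of_negative_lower_ordinate Hneg) as (phi & H0 & Hne).
        apply Hne, Hinj; trivial; rewrite H0, (diff_op_0 _ _ p); trivial.
      - destruct (Hsurj (fun _ => 1%C) I) as (f & _ & Hf).
        apply equal_f with (x := 0%nat) in Hf.
        rewrite (diff_op_matrix _ _ _ p) in Hf by trivial; rewrite csum_0 in Hf.
        + now apply C1_nz.
        + intros l _; rewrite op_matrix_0 by lia; ring. }
    (* At a first resonance [n], a solution of P f = z^n has no coefficient below [n], because the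
       earlier rows have nonzero diagonal; row [n] then reads 0 = 1. *)
    split; trivial; intros n; induction n as [n IH] using lt_wf_ind; intros Hn.
    destruct (Hsurj (fun k => if Nat.eqb k n then 1%C else 0%C) I) as (f & _ & Hf).
    assert (Hlow : forall k, (k < n)%nat -> f k = 0%C).
    { intros k; induction k as [k IHk] using lt_wf_ind; intros Hk.
      pose proof (equal_f Hf k) as E; simpl in E.
      rewrite diff_op_triangular, csum_0 in E by
        (trivial; intros l Hl; apply in_seq in Hl; rewrite IHk by lia; ring).
      destruct (Nat.eqb_spec k n); [lia|].
      destruct (classic (f k = 0%C)) as [|Hne]; trivial; exfalso.
      apply (Cmult_neq_0 _ _ (IH k Hk) Hne); rewrite <- E; ring. }
    pose proof (equal_f Hf n) as E; simpl in E.
    rewrite Nat.eqb_refl, diff_op_triangular, csum_0, Hn in E by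
      (trivial; intros l Hl; apply in_seq in Hl; rewrite Hlow by lia; ring).
    apply C1_nz; rewrite <- E; ring.
  - intros [Hm HW]; split; [trivial|]; split; [|split; [|split]].
    + intros; now apply (diff_op_add _ _ p).
    + intros; now apply (diff_op_scal _ _ p).
    + intros f g _ _; now apply diff_op_injective.
    + intros g _; destruct (diff_op_surjective Hm HW g) as [f Hf]; now exists f.
Qed.

End FormalOperator.

(** * The first positive slope *)

Lemma list_argmin (P : nat -> Prop) (f : nat -> R) (l : list nat) :
  (exists x, In x l /\ P x) ->
  exists x, In x l /\ P x /\ forall y, In y l -> P y -> f x <= f y.
Proof.
  induction l as [|a l IH]; intros (x & Hx & HPx); [destruct Hx|].
  destruct (classic (exists y, In y l /\ P y)) as [Hl|Hl].
  - destruct (IH Hl) as (y & Hy & HPy & Hmin).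
    destruct (classic (P a /\ f a <= f y)) as [[HPa Ha]|Ha].
    + exists a; split; [now left|]; split; trivial.
      intros z [<-|Hz] HPz; [apply Rle_refl|].
      specialize (Hmin z Hz HPz); lra.
    + exists y; split; [now right|]; split; trivial.
      intros z [<-|Hz] HPz; [|now apply Hmin].
      destruct (Rle_lt_dec (f a) (f y)); [tauto|now left].
  - exists x; split; trivial; split; trivial; intros y Hy HPy.
    destruct Hx as [->|Hx]; [|exfalso; apply Hl; now exists x].
    destruct Hy as [->|Hy]; [apply Rle_refl|exfalso; apply Hl; now exists y].
Qed.

Lemma IZR_ordinate alpha j : IZR (ordinate alpha j) = INR (alpha j) - INR j.
Proof. unfold ordinate; now rewrite minus_IZR, <- !INR_IZR_INZ. Qed.

Lemma newton_polygon_point Lambda alpha j :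
  In j Lambda -> newton_polygon Lambda alpha (INR j, INR (alpha j) - INR j).
Proof.
  intros Hj K _ HK; apply HK; exists j; split; trivial.
  unfold quadrant; simpl; rewrite IZR_ordinate; lra.
Qed.

(** A half-plane is a convex test set for the hull. The quadrants extend to the left and upward, so
    with these signs of [u] and [v] it is enough to check their corners. *)
Lemma newton_polygon_half_plane Lambda alpha (u v w : R) :
  u <= 0 -> 0 <= v ->
  (forall j, In j Lambda -> w <= u * INR j + v * (INR (alpha j) - INR j)) ->
  forall q, newton_polygon Lambda alpha q -> w <= u * fst q + v * snd q.
Proof.
  intros Hu Hv Hw q Hq.
  apply (Hq (fun q => w <= u * fst q + v * snd q)).
  - intros [x1 y1] [x2 y2] t H1 H2 Ht; simpl in *; nra.
  - intros [x y] (j & Hj & Hx & Hy); simpl in *.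
    rewrite IZR_ordinate in Hy; specialize (Hw j Hj); nra.
Qed.

(** The quadrants are stable under this translation, and the preimage of a convex set under it is
    convex, hence again a test set for the hull. *)
Lemma newton_polygon_quadrant Lambda alpha x y t :
  0 <= t -> newton_polygon Lambda alpha (x, y) ->
  newton_polygon Lambda alpha (x - t, y + t).
Proof.
  intros Ht Hq K HK HS.
  assert (HK' : convex_set (fun q => K (fst q - t, snd q + t))).
  { intros [x1 y1] [x2 y2] r H1 H2 Hr; simpl in *.
    specialize (HK _ _ r H1 H2 Hr); simpl in HK.
    replace ((1 - r) * x1 + r * x2 - t)
      with ((1 - r) * (x1 - t) + r * (x2 - t)) by ring.
    replace ((1 - r) * y1 + r * y2 + t)
      with ((1 - r) * (y1 + t) + r * (y2 + t)) by ring; trivial. }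
  apply (Hq _ HK'); intros [x1 y1] (j & Hj & H1 & H2); apply HS; exists j.
  split; trivial; unfold quadrant in *; simpl in *; lra.
Qed.

Section FirstPositiveSlope.

Context (Lambda : list nat) (alpha : nat -> nat) (J : nat) (s : R).
Hypothesis hs : 0 <= s.
Hypothesis halpha : forall j, In j Lambda -> (j <= alpha j)%nat.
Hypothesis hJ : In J Lambda.
Hypothesis hJ0 : alpha J = J.
Hypothesis hJmax : forall j, In j Lambda -> alpha j = j -> (j <= J)%nat.

(** The supporting line of the edge passes below or through [(J, 0)], so the upper end [(x2, y2)]
    satisfies [y2 <= sigma * (x2 - J)]. The hypothesis gives [x2 - J <= s * y2] on the whole
    polygon, and [y2 > 0] can be cancelled. *)
Lemma slope_of_edge E sigma :
  (forall j, In j Lambda -> INR j - INR J <= s * (INR (alpha j) - INR j)) ->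
  0 < sigma -> is_edge (newton_polygon Lambda alpha) E -> edge_slope E sigma ->
  1 <= s * sigma.
Proof.
  intros Hc Hsig [(u & v & w & Huv & HN & HE) _] (q1 & q2 & H1 & H2 & Hne & Hs).
  assert (Hwlog : exists x1 y1 x2 y2,
    newton_polygon Lambda alpha (x1, y1) /\ newton_polygon Lambda alpha (x2, y2) /\
    u * x1 + v * y1 = w /\ u * x2 + v * y2 = w /\ x1 < x2 /\
    y2 - y1 = sigma * (x2 - x1)).
  { apply HE in H1 as [N1 E1]; apply HE in H2 as [N2 E2].
    destruct q1 as [x1 y1], q2 as [x2 y2]; simpl in *.
    assert (Hy : y2 - y1 = sigma * (x2 - x1)) by (rewrite Hs; field; lra).
    destruct (Rlt_le_dec x1 x2).
    - exists x1, y1, x2, y2; tauto.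
    - exists x2, y2, x1, y1; repeat split; trivial; lra. }
  destruct Hwlog as (x1 & y1 & x2 & y2 & N1 & N2 & E1 & E2 & Hlt & Hy).
  assert (Hy1 : 0 <= 0 * x1 + 1 * y1).
  { apply (newton_polygon_half_plane Lambda alpha 0 1 0) with (q := (x1, y1));
      trivial; try lra.
    intros j Hj; specialize (halpha j Hj); apply le_INR in halpha; lra. }
  assert (Hx2 : - INR J <= - (1) * x2 + s * y2).
  { apply (newton_polygon_half_plane Lambda alpha (- (1)) s (- INR J))
      with (q := (x2, y2)); trivial; try lra.
    intros j Hj; specialize (Hc j Hj); lra. }
  assert (Hu : u = - v * sigma).
  { assert (u * (x2 - x1) + v * (sigma * (x2 - x1)) = 0) by (rewrite <- Hy; lra).
    assert ((u + v * sigma) * (x2 - x1) = 0) by lra.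
    destruct (Rmult_integral _ _ H0); lra. }
  (* [v > 0] because the polygon also contains [(x2 - 1, y2 + 1)]. *)
  assert (Hv : 0 < v).
  { pose proof (HN _ (newton_polygon_quadrant _ _ _ _ 1 Rle_0_1 N2)) as H;
      simpl in H.
    assert (v <> 0) by (intros ->; destruct Huv as [Huv|Huv]; apply Huv; lra).
    assert (0 <= v * (1 + sigma)) by nra.
    destruct (Rle_lt_dec v 0); trivial; nra. }
  pose proof (HN _ (newton_polygon_point Lambda alpha J hJ)) as HJw; simpl in HJw.
  rewrite hJ0 in HJw.
  assert (Hy2 : v * (y2 - sigma * (x2 - INR J)) <= 0) by (rewrite Hu in *; lra).
  assert (y2 <= sigma * (x2 - INR J)) by nra.
  assert (0 < y2) by nra.
  assert (y2 <= sigma * (s * y2)) by nra.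
  nra.
Qed.

(** Among the lines joining [(J, 0)] to the corners to its right, the flattest one supports the
    polygon. Its slope is at most that of the line through the corner of [j], on which the condition
    fails. *)
Lemma minimal_slope_edge j :
  In j Lambda -> s * (INR (alpha j) - INR j) < INR j - INR J ->
  exists sigma E, 0 < sigma /\ s * sigma < 1 /\
    is_edge (newton_polygon Lambda alpha) E /\ edge_slope E sigma.
Proof.
  intros Hj Hlt.
  assert (Hpos : forall i, In i Lambda -> (J < i)%nat ->
    0 < INR i - INR J /\ 0 < INR (alpha i) - INR i).
  { intros i Hi HJi; pose proof (lt_INR _ _ HJi).
    specialize (halpha i Hi); specialize (hJmax i Hi).
    assert (i < alpha i)%nat as Hi' by lia; apply lt_INR in Hi'; lra. }
  assert (HJj : (J < j)%nat).
  { apply INR_lt; specialize (halpha j Hj); apply le_INR in halpha; nra. }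
  set (f := fun i => (INR (alpha i) - INR i) / (INR i - INR J)).
  destruct (list_argmin (fun i => (J < i)%nat) f Lambda) as (i & Hi & HJi & Hmin).
  { now exists j. }
  destruct (Hpos i Hi HJi) as [Hi1 Hi2]; destruct (Hpos j Hj HJj) as [Hj1 Hj2].
  set (sigma := f i).
  assert (Hsig : 0 < sigma) by now apply Rdiv_lt_0_compat.
  exists sigma, (fun q => newton_polygon Lambda alpha q /\
    - sigma * fst q + 1 * snd q = - sigma * INR J).
  assert (HEJ : newton_polygon Lambda alpha (INR J, INR (alpha J) - INR J) /\
    - sigma * INR J + 1 * (INR (alpha J) - INR J) = - sigma * INR J).
  { split; [now apply newton_polygon_point|]; rewrite hJ0; lra. }
  assert (HEi : newton_polygon Lambda alpha (INR i, INR (alpha i) - INR i) /\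
    - sigma * INR i + 1 * (INR (alpha i) - INR i) = - sigma * INR J).
  { split; [now apply newton_polygon_point|]; unfold sigma, f; field; lra. }
  split; [trivial|]; split; [|split; [split|]].
  - specialize (Hmin j Hj HJj); fold sigma in Hmin.
    apply Rle_lt_trans with (s * f j); [now apply Rmult_le_compat_l|].
    apply Rmult_lt_reg_r with (INR j - INR J); trivial.
    unfold f; replace (s * _ * _) with (s * (INR (alpha j) - INR j)); [lra|].
    field; lra.
  - exists (- sigma), 1, (- sigma * INR J); split; [right; lra|]; split; [|tauto].
    apply newton_polygon_half_plane; try lra; intros k Hk.
    (* Corners with [k <= J] have ordinate at least 0, while the line is at most 0 there; those with
       [k > J] are handled by minimality of [sigma]. *)
    destruct (le_lt_dec k J) as [HkJ|HkJ].
    + apply le_INR in HkJ; specialize (halpha k Hk); apply le_INR in halpha; nra.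
    + destruct (Hpos k Hk HkJ) as [Hk1 Hk2]; specialize (Hmin k Hk HkJ).
      fold sigma in Hmin.
      assert (sigma * (INR k - INR J) <= INR (alpha k) - INR k); [|lra].
      replace (INR (alpha k) - INR k) with (f k * (INR k - INR J))
        by (unfold f; field; lra).
      apply Rmult_le_compat_r; lra.
  - exists (INR J, INR (alpha J) - INR J), (INR i, INR (alpha i) - INR i).
    split; [exact HEJ|]; split; [exact HEi|]; intros E; injection E; lra.
  - exists (INR J, INR (alpha J) - INR J), (INR i, INR (alpha i) - INR i).
    split; [exact HEJ|]; split; [exact HEi|]; simpl; split; [lra|].
    rewrite hJ0; unfold sigma, f; f_equal; ring.
Qed.

Lemma first_positive_slope_ge_iff :
  Rbar_le (inv_Rbar s) (first_positive_slope (newton_polygon Lambda alpha)) <->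
  forall j, In j Lambda -> INR j - INR J <= s * (INR (alpha j) - INR j).
Proof.
  unfold first_positive_slope; split.
  - intros H j Hj; apply Rnot_lt_le; intros Hlt.
    destruct (minimal_slope_edge j Hj Hlt) as (sigma & E & Hsig & Hs & HE & HEs).
    destruct (Glb_Rbar_correct (fun sigma => 0 < sigma /\
      exists E, is_edge (newton_polygon Lambda alpha) E /\ edge_slope E sigma))
      as [Hlb _].
    assert (Hle : Rbar_le (inv_Rbar s) sigma).
    { eapply Rbar_le_trans; [exact H|]; apply Hlb.
      split; trivial; now exists E. }
    (* For [s = 0] the bound is [p_infty], so [Hle] reduces to [False]: no edge of positive slope is
       allowed. *)
    unfold inv_Rbar in Hle; destruct (Req_EM_T s 0) as [|Hs0]; [exact Hle|].
    simpl in Hle; apply Rmult_le_compat_l with (r := s) in Hle; trivial.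
    rewrite Rinv_r in Hle by trivial; lra.
  - intros Hc; apply Glb_Rbar_correct; intros sigma (Hsig & E & HE & HEs).
    pose proof (slope_of_edge E sigma Hc Hsig HE HEs) as H.
    unfold inv_Rbar; destruct (Req_EM_T s 0) as [->|Hs0]; simpl; [lra|].
    apply Rmult_le_reg_l with s; [lra|]; rewrite Rinv_r; trivial.
Qed.

End FirstPositiveSlope.

(** * Gevrey growth in terms of factorials *)

(** [RInt_gen] has a meaning only once convergence is proved. For a nonnegative integrand the
    integrals over [[a, b]] increase with the interval, so they converge to their supremum. *)
Lemma RInt_gen_half_line_bounds (f : R -> R) (M : R) :
  (forall t, 0 < t -> continuous f t) -> (forall t, 0 < t -> 0 <= f t) ->
  (forall a b, 0 < a -> a <= b -> RInt f a b <= M) ->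
  forall a b, 0 < a -> a <= b ->
    RInt f a b <= RInt_gen f (at_right 0) (Rbar_locally p_infty) <= M.
Proof.
  intros Hc Hf HM.
  assert (Hex : forall a b, 0 < a -> a <= b -> ex_RInt f a b).
  { intros a b Ha Hab; apply @ex_RInt_continuous; intros z Hz.
    rewrite Rmin_left in Hz by trivial; apply Hc; lra. }
  assert (Hge : forall a b, 0 < a -> a <= b -> 0 <= RInt f a b).
  { intros a b Ha Hab; apply RInt_ge_0; trivial; [now apply Hex|].
    intros; apply Hf; lra. }
  assert (Hmono : forall a b a' b', 0 < a' -> a' <= a -> a <= b -> b <= b' ->
    RInt f a b <= RInt f a' b').
  { intros a b a' b' H1 H2 H3 H4.
    assert (E1 : RInt f a' a + RInt f a b' = RInt f a' b')
      by (apply @RInt_Chasles; apply Hex; lra).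
    assert (E2 : RInt f a b + RInt f b b' = RInt f a b')
      by (apply @RInt_Chasles; apply Hex; lra).
    assert (0 <= RInt f a' a) by (apply Hge; lra).
    assert (0 <= RInt f b b') by (apply Hge; lra).
    lra. }
  destruct (completeness
    (fun v => exists a b, 0 < a /\ a <= b /\ v = RInt f a b)) as [l [Hub Hlub]].
  { exists M; intros v (a & b & Ha & Hab & ->); now apply HM. }
  { exists (RInt f 1 1), 1, 1; repeat split; lra. }
  assert (Hl : is_RInt_gen f (at_right 0) (Rbar_locally p_infty) l).
  { intros P [eps HP]; unfold filtermapi.
    assert (Hclose : exists a0 b0, 0 < a0 /\ a0 <= b0 /\ l - eps < RInt f a0 b0).
    { apply NNPP; intros Hno.
      assert (l <= l - eps); [|destruct eps; simpl in *; lra].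
      apply Hlub; intros v (a & b & Ha & Hab & ->).
      apply Rnot_lt_le; intros Hlt; apply Hno; now exists a, b. }
    destruct Hclose as (a0 & b0 & Ha0 & Hab0 & Hlt).
    exists (fun a => 0 < a < a0) (fun b => b0 < b).
    - exists (mkposreal _ Ha0); intros a Ha Hpos; simpl in Ha.
      unfold ball in Ha; simpl in Ha; unfold AbsRing_ball in Ha.
      unfold abs, minus, plus, opp in Ha; simpl in Ha.
      rewrite Rabs_pos_eq in Ha; lra.
    - now exists b0.
    - intros a b [Ha1 Ha2] Hb; exists (RInt f a b); simpl; split.
      + apply (RInt_correct (V := R_CompleteNormedModule)), Hex; lra.
      + apply HP; change (Rabs (RInt f a b - l) < eps).
        assert (RInt f a b <= l) by (apply Hub; exists a, b; repeat split; lra).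
        assert (RInt f a0 b0 <= RInt f a b) by (apply Hmono; lra).
        rewrite Rabs_left1; lra. }
  intros a b Ha Hab.
  rewrite (is_RInt_gen_unique f l Hl); split.
  - apply Hub; now exists a, b.
  - apply Hlub; intros v (a' & b' & Ha' & Hab' & ->); now apply HM.
Qed.

Lemma Gamma_integrand_continuous x t :
  0 < t -> continuous (fun t => Rpower t (x - 1) * exp (- t)) t.
Proof.
  intros Ht; apply (ex_derive_continuous (V := R_NormedModule)).
  unfold Rpower; auto_derive; lra.
Qed.

Lemma Gamma_integrand_nonneg x t : 0 <= Rpower t (x - 1) * exp (- t).
Proof. left; apply Rmult_lt_0_compat; apply exp_pos. Qed.

(** The number [2 * K] is the integral of the dominating function [K * exp (- t / 2)] over the
    half-line. *)
Lemma Gamma_bounds (x K : R) :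
  0 <= K ->
  (forall t, 0 < t -> Rpower t (x - 1) * exp (- t) <= K * exp (- t / 2)) ->
  forall a b, 0 < a -> a <= b ->
    RInt (fun t => Rpower t (x - 1) * exp (- t)) a b <= Gamma x <= 2 * K.
Proof.
  intros HK Hle; unfold Gamma; apply RInt_gen_half_line_bounds.
  - intros t Ht; now apply Gamma_integrand_continuous.
  - intros t _; apply Gamma_integrand_nonneg.
  - intros a b Ha Hab.
    assert (HI : is_RInt (fun t => K * exp (- t / 2)) a b
                   (minus (- 2 * K * exp (- b / 2)) (- 2 * K * exp (- a / 2)))).
    { apply (is_RInt_derive (fun t => - 2 * K * exp (- t / 2))).
      - intros t _; auto_derive; trivial; unfold Rdiv; field.
      - intros t _; apply (ex_derive_continuous (V := R_NormedModule)).
        auto_derive; trivial. }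
    eapply Rle_trans.
    + apply (RInt_le _ (fun t => K * exp (- t / 2))); trivial.
      * apply @ex_RInt_continuous; intros z Hz.
        rewrite Rmin_left in Hz by trivial; apply Gamma_integrand_continuous; lra.
      * eexists; exact HI.
      * intros t Ht; apply Hle; lra.
    + rewrite (is_RInt_unique _ _ _ _ HI).
      unfold minus, plus, opp; simpl.
      assert (exp (- a / 2) <= 1)
        by (rewrite <- exp_0; left; apply exp_increasing; lra).
      pose proof (exp_pos (- b / 2)); nra.
Qed.

Lemma pow_le_fact_exp (u : R) n : 0 <= u -> u ^ n <= INR (fact n) * exp u.
Proof.
  intros Hu; pose proof (INR_fact_lt_0 n) as Hf.
  apply Rmult_le_reg_l with (/ INR (fact n)); [now apply Rinv_0_lt_compat|].
  rewrite <- Rmult_assoc, Rinv_l, Rmult_1_l by lra.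
  eapply Rle_trans; [|exact (exp_ge_taylor u n Hu)].
  destruct n as [|n]; [simpl; lra|].
  rewrite tech5; unfold Rdiv; rewrite Rmult_comm.
  assert (0 <= sum_f_R0 (fun k => u ^ k / INR (fact k)) n); [|unfold Rdiv in *; lra].
  apply cond_pos_sum; intros k; apply Rdiv_le_0_compat;
    [now apply pow_le | apply INR_fact_lt_0].
Qed.

Definition fact_power (s : R) (n : nat) : R := Rpower (INR (fact n)) s.

Lemma fact_power_pos s n : 0 < fact_power s n.
Proof. apply exp_pos. Qed.

Lemma Rpower_pow_swap (t s : R) n : 0 < t -> Rpower t s ^ n = Rpower t (s * INR n).
Proof.
  intros Ht; rewrite <- Rpower_mult, Rpower_pow; trivial; apply exp_pos.
Qed.

Lemma fact_power_0_r n : fact_power 0 n = 1.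
Proof. apply Rpower_O, INR_fact_lt_0. Qed.

(* [(t / 2s)^n <= n! e^(t / 2s)], raised to the power [s]. *)
Lemma Gamma_integrand_le (s t : R) n :
  0 < s -> 0 < t ->
  Rpower t (s * INR n) * exp (- t) <=
  Rpower (2 * s) s ^ n * fact_power s n * exp (- t / 2).
Proof.
  intros Hs Ht.
  assert (Hu : 0 < t / (2 * s)) by (apply Rdiv_lt_0_compat; lra).
  pose proof (pow_le_fact_exp (t / (2 * s)) n (Rlt_le _ _ Hu)) as H.
  apply (fun H => Rle_Rpower_l _ _ s (Rlt_le _ _ Hs) (conj (pow_lt _ n Hu) H)) in H.
  rewrite <- (Rpower_pow n) in H by trivial.
  rewrite Rpower_mult, (Rmult_comm (INR n)) in H.
  rewrite <- Rpower_mult_distr in H by (apply INR_fact_lt_0 || apply exp_pos).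
  replace (Rpower (exp (t / (2 * s))) s) with (exp (t / 2)) in H.
  2: { unfold Rpower; rewrite ln_exp; f_equal; field; lra. }
  fold (fact_power s n) in H.
  assert (Hsplit : Rpower t (s * INR n) =
    Rpower (2 * s) s ^ n * Rpower (t / (2 * s)) (s * INR n)).
  { rewrite Rpower_pow_swap by lra.
    rewrite Rpower_mult_distr by (trivial; lra); f_equal; field; lra. }
  rewrite Hsplit.
  replace (exp (- t / 2)) with (exp (t / 2) * exp (- t))
    by (rewrite <- exp_plus; f_equal; field).
  rewrite <- !Rmult_assoc; apply Rmult_le_compat_r; [left; apply exp_pos|].
  rewrite !Rmult_assoc; apply Rmult_le_compat_l; trivial.
  apply pow_le; left; apply exp_pos.
Qed.

Lemma fact_le_pow n : INR (fact n) <= INR n ^ n.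
Proof.
  rewrite <- pow_INR; apply le_INR.
  induction n as [|n IH]; [trivial|].
  change (fact (S n)) with (S n * fact n)%nat.
  rewrite Nat.pow_succ_r'; apply Nat.mul_le_mono_l.
  eapply Nat.le_trans; [exact IH|]; apply Nat.pow_le_mono_l; lia.
Qed.

Lemma fact_power_growth s n : 0 <= s ->
  fact_power s n <= Rpower (INR n) (s * INR n).
Proof.
  intros Hs; destruct n as [|n].
  - unfold fact_power, Rpower; simpl; rewrite Rmult_0_r, Rmult_0_l, ln_1.
    rewrite Rmult_0_r; apply Rle_refl.
  - assert (0 < INR (S n)) by (apply lt_0_INR; lia).
    unfold fact_power; eapply Rle_trans.
    + apply Rle_Rpower_l; trivial.
      split; [apply INR_fact_lt_0 | apply fact_le_pow].
    + rewrite <- (Rpower_pow (S n)), Rpower_mult by trivial.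
      rewrite Rmult_comm; apply Rle_refl.
Qed.

Lemma Gamma_lower_bound (x K a v : R) :
  0 <= K ->
  (forall t, 0 < t -> Rpower t (x - 1) * exp (- t) <= K * exp (- t / 2)) ->
  0 < a -> (forall t, a < t < a + 1 -> v <= Rpower t (x - 1) * exp (- t)) ->
  v <= Gamma x.
Proof.
  intros HK Hle Ha Hv.
  eapply Rle_trans;
    [|apply (Gamma_bounds x K HK Hle a (a + 1)); lra].
  replace v with (RInt (fun _ => v) a (a + 1)).
  - apply RInt_le; trivial; [lra|apply ex_RInt_const|].
    apply @ex_RInt_continuous; intros z Hz.
    rewrite Rmin_left in Hz by lra; apply Gamma_integrand_continuous; lra.
  - rewrite RInt_const; unfold scal; simpl; unfold mult; simpl; ring.
Qed.

(** No Stirling formula is required. The upper bound integrates [Gamma_integrand_le]. For the lower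
    one, the integrand on the unit interval after [1 + s * n] is at least (s n)^(s n) e^(-2 - s n),
    and n^n >= n!. *)
Lemma Gamma_fact_power_bounds (s : R) :
  0 <= s ->
  exists A, 0 < A /\ forall n,
    Gamma (1 + s * INR n) <= 2 * A ^ n * fact_power s n /\
    fact_power s n <= exp 2 * A ^ n * Gamma (1 + s * INR n).
Proof.
  intros Hs.
  assert (Hx : forall n, 1 + s * INR n - 1 = s * INR n) by (intros; ring).
  (* The constants below contain s^s and the rescaling t / 2s, which degenerate at [s = 0]; there
     the integrand is just e^(-t). *)
  destruct (Req_dec s 0) as [Hs0|Hs0].
  - exists 1; split; [lra|]; intros n; rewrite pow1.
    assert (Hf : forall t, 0 < t ->
      Rpower t (1 + s * INR n - 1) * exp (- t) = exp (- t)).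
    { intros t Ht; rewrite Hx, Hs0, Rmult_0_l, Rpower_O by trivial; ring. }
    assert (Hle : forall t, 0 < t ->
      Rpower t (1 + s * INR n - 1) * exp (- t) <= 1 * exp (- t / 2)).
    { intros t Ht; rewrite Hf, Rmult_1_l by trivial.
      left; apply exp_increasing; lra. }
    rewrite Hs0 at 2 3; rewrite fact_power_0_r; split.
    + destruct (Gamma_bounds _ 1 Rle_0_1 Hle 1 1); lra.
    + replace 1 with (exp 2 * exp (- 2)) at 1
        by (rewrite <- exp_plus, <- exp_0; f_equal; ring).
      rewrite Rmult_1_r; apply Rmult_le_compat_l; [left; apply exp_pos|].
      apply (Gamma_lower_bound _ 1 1 _ Rle_0_1 Hle); [lra|].
      intros t Ht; rewrite Hf by lra; left; apply exp_increasing; lra.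
  - assert (Hspos : 0 < s) by lra.
    (* [A1] is the rate of the upper bound and [1 / A2] that of the lower one; [A1 + A2] serves for
       both. *)
    set (A1 := Rpower (2 * s) s); set (A2 := exp s / Rpower s s).
    assert (HA1 : 0 < A1) by apply exp_pos.
    assert (HA2 : 0 < A2) by (apply Rdiv_lt_0_compat; apply exp_pos).
    exists (A1 + A2); split; [lra|]; intros n.
    assert (HK : 0 <= A1 ^ n * fact_power s n).
    { apply Rmult_le_pos; [apply pow_le; lra | left; apply fact_power_pos]. }
    assert (Hle : forall t, 0 < t ->
      Rpower t (1 + s * INR n - 1) * exp (- t) <=
      A1 ^ n * fact_power s n * exp (- t / 2)).
    { intros t Ht; rewrite Hx; now apply Gamma_integrand_le. }
    assert (HG : exp (- 2) * (/ A2) ^ n * fact_power s n <= Gamma (1 + s * INR n)).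
    { pose proof (pos_INR n) as Hn; pose proof (Rmult_le_pos _ _ Hs Hn) as Hsn.
      apply (Gamma_lower_bound _ _ (1 + s * INR n) _ HK Hle); [lra|].
      intros t Ht; rewrite Hx.
      apply Rle_trans with (Rpower t (s * INR n) * (exp (- 2) * exp (- s) ^ n)).
      - replace ((/ A2) ^ n) with (Rpower s s ^ n * exp (- s) ^ n).
        2: { rewrite <- Rpow_mult_distr; f_equal; unfold A2, Rdiv.
             rewrite Rinv_mult, Rinv_inv, exp_Ropp; ring. }
        replace (exp (- 2) * (Rpower s s ^ n * exp (- s) ^ n) * fact_power s n)
          with (Rpower s s ^ n * fact_power s n * (exp (- 2) * exp (- s) ^ n)) by ring.
        apply Rmult_le_compat_r.
        { left; apply Rmult_lt_0_compat; [|apply pow_lt]; apply exp_pos. }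
        eapply Rle_trans;
          [apply Rmult_le_compat_l;
             [apply pow_le; left; apply exp_pos | now apply fact_power_growth]|].
        destruct n as [|n].
        { simpl pow; simpl INR; rewrite !Rmult_0_r; unfold Rpower.
          rewrite !Rmult_0_l, exp_0; lra. }
        assert (0 < INR (S n)) by (apply lt_0_INR; lia).
        rewrite Rpower_pow_swap, Rpower_mult_distr by trivial.
        apply Rle_Rpower_l; [trivial|]; split; [|lra].
        now apply Rmult_lt_0_compat.
      - apply Rmult_le_compat_l; [left; apply exp_pos|].
        replace (exp (- s) ^ n) with (exp (- (s * INR n))).
        2: { rewrite <- Rpower_pow by apply exp_pos.
             unfold Rpower; rewrite ln_exp; f_equal; ring. }
        rewrite <- exp_plus; left; apply exp_increasing; lra. }
    assert (Hpow1 : A1 ^ n <= (A1 + A2) ^ n) by (apply pow_incr; lra).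
    assert (Hpow2 : A2 ^ n <= (A1 + A2) ^ n) by (apply pow_incr; lra).
    pose proof (fact_power_pos s n) as Hfp; split.
    + apply Rle_trans with (2 * (A1 ^ n * fact_power s n)).
      * destruct (Gamma_bounds _ _ HK Hle 1 1); lra.
      * rewrite Rmult_assoc; apply Rmult_le_compat_l; [lra|].
        apply Rmult_le_compat_r; lra.
    + apply Rmult_le_compat_l with (r := exp 2 * A2 ^ n) in HG.
      2: { apply Rmult_le_pos; [left; apply exp_pos | apply pow_le; lra]. }
      replace (exp 2 * A2 ^ n * (exp (- 2) * (/ A2) ^ n * fact_power s n))
        with (fact_power s n) in HG.
      2: { replace (exp (- 2)) with (/ exp 2) by (rewrite <- exp_Ropp; f_equal; lra).
           rewrite pow_inv; field; split;
             [apply pow_nonzero; lra | apply Rgt_not_eq, exp_pos]. }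
      eapply Rle_trans; [exact HG|]; apply Rmult_le_compat_r.
      * destruct (Gamma_bounds _ _ HK Hle 1 1) as [H1 H2]; [lra|lra|].
        rewrite RInt_point in H1; exact H1.
      * apply Rmult_le_compat_l; [left; apply exp_pos|trivial].
Qed.

Definition fact_gevrey (s : R) (phi : fps) : Prop :=
  exists M A, 0 < M /\ 0 < A /\
    forall n, Cmod (phi n) <= M * A ^ n * fact_power s n.

Lemma gevrey_iff_fact_gevrey (s : R) (phi : fps) :
  0 <= s -> gevrey s phi <-> fact_gevrey s phi.
Proof.
  intros Hs; destruct (Gamma_fact_power_bounds s Hs) as (B & HB & Hn).
  split; intros (M & A & HM & HA & H).
  - exists (M * 2), (A * B); repeat split; try (apply Rmult_lt_0_compat; lra).
    intros n; eapply Rle_trans; [apply H|].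
    rewrite Rpow_mult_distr.
    replace (M * 2 * (A ^ n * B ^ n) * fact_power s n)
      with (M * A ^ n * (2 * B ^ n * fact_power s n)) by ring.
    apply Rmult_le_compat_l; [|apply Hn].
    apply Rmult_le_pos; [lra | apply pow_le; lra].
  - pose proof (exp_pos 2).
    exists (M * exp 2), (A * B); repeat split; try (apply Rmult_lt_0_compat; lra).
    intros n; eapply Rle_trans; [apply H|].
    rewrite Rpow_mult_distr.
    replace (M * exp 2 * (A ^ n * B ^ n) * Gamma (1 + s * INR n))
      with (M * A ^ n * (exp 2 * B ^ n * Gamma (1 + s * INR n))) by ring.
    apply Rmult_le_compat_l; [|apply Hn].
    apply Rmult_le_pos; [lra | apply pow_le; lra].
Qed.

Lemma fact_power_le s l n :
  0 <= s -> (l <= n)%nat -> fact_power s l <= fact_power s n.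
Proof.
  intros Hs Hln; apply Rle_Rpower_l; trivial; split; [apply INR_fact_lt_0|].
  now apply le_INR, fact_le.
Qed.

Lemma fact_pow_le l d : INR (S l) ^ d * INR (fact l) <= INR (fact (l + d)).
Proof.
  rewrite <- pow_INR, <- mult_INR; apply le_INR.
  induction d as [|d IH]; [rewrite Nat.add_0_r; simpl; lia|].
  rewrite Nat.add_succ_r; change (fact (S (l + d))) with (S (l + d) * fact (l + d))%nat.
  rewrite Nat.pow_succ_r', <- Nat.mul_assoc; apply Nat.mul_le_mono; trivial; lia.
Qed.

(** The quotient n! / l! has [n - l] factors, each at least [l + 1]. Thus a shift of indices pays
    for a power of [l + 1]; this is how condition (c) enters the estimates. *)
Lemma fact_power_ratio s e l n :
  0 <= s -> (l <= n)%nat -> e <= s * (INR n - INR l) ->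
  Rpower (INR (S l)) e * fact_power s l <= fact_power s n.
Proof.
  intros Hs Hln He.
  assert (Hl : 0 < INR (S l)) by (apply lt_0_INR; lia).
  apply Rle_trans with (Rpower (INR (S l)) (s * INR (n - l)) * fact_power s l).
  - apply Rmult_le_compat_r; [left; apply fact_power_pos|].
    apply Rle_Rpower; [apply (le_INR 1); lia|].
    now rewrite minus_INR.
  - unfold fact_power; rewrite (Rmult_comm s), <- Rpower_mult, Rpower_pow by trivial.
    rewrite Rpower_mult_distr by (apply INR_fact_lt_0 || now apply pow_lt).
    apply Rle_Rpower_l; trivial; split.
    + apply Rmult_lt_0_compat; [now apply pow_lt | apply INR_fact_lt_0].
    + replace n with (l + (n - l))%nat at 2 by lia; apply fact_pow_le.
Qed.

(** * Gevrey solutions *)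

Lemma bounded_of_eventually (u : nat -> R) (M : R) :
  eventually (fun n => u n <= M) -> exists M', forall n, u n <= M'.
Proof.
  intros [N HN]; revert M HN; induction N as [|N IH]; intros M HN.
  - exists M; intros n; apply HN; lia.
  - apply (IH (Rmax M (u N))); intros n Hn.
    destruct (Nat.eq_dec n N) as [->|]; [apply Rmax_r|].
    eapply Rle_trans; [apply HN; lia | apply Rmax_l].
Qed.

Lemma lower_bound_of_eventually (u v : nat -> R) (kappa : R) :
  0 < kappa -> (forall n, 0 < u n) -> (forall n, 0 <= v n) ->
  eventually (fun n => kappa * v n <= u n) ->
  exists kappa', 0 < kappa' /\ forall n, kappa' * v n <= u n.
Proof.
  intros Hk Hu Hv [N HN]; revert kappa Hk HN; induction N as [|N IH]; intros kappa Hk HN.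
  - exists kappa; split; trivial; intros n; apply HN; lia.
  - assert (Hq : 0 < u N / (v N + 1))
      by (apply Rdiv_lt_0_compat; [apply Hu | specialize (Hv N); lra]).
    apply (IH (Rmin kappa (u N / (v N + 1)))); [now apply Rmin_glb_lt|].
    intros n Hn; specialize (Hv n); destruct (Nat.eq_dec n N) as [->|].
    + apply Rle_trans with (u N / (v N + 1) * (v N + 1)).
      * apply Rmult_le_compat; try lra; [|apply Rmin_r].
        apply Rmin_glb; lra.
      * right; field; lra.
    + apply Rle_trans with (kappa * v n); [|apply HN; lia].
      apply Rmult_le_compat_r; trivial; apply Rmin_l.
Qed.

(** The terms of a series that converges at a real point [r] are bounded. Taking [r <= 1] makes the
    rate [/ r] at least 1. *)
Lemma taylor_coefficients_bound (f : C -> C) (c : fps) :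
  is_taylor_at_0 f c ->
  exists K B, 0 <= K /\ 1 <= B /\ forall k, Cmod (c k) <= K * B ^ k.
Proof.
  intros [eps Heps].
  set (r := Rmin (eps / 2) 1).
  assert (Hr : 0 < r < eps /\ r <= 1).
  { destruct eps as [e He]; simpl in *; unfold r.
    pose proof (Rmin_l (e / 2) 1); pose proof (Rmin_r (e / 2) 1).
    assert (0 < Rmin (e / 2) 1) by (apply Rmin_glb_lt; lra); lra. }
  assert (Hser : is_pseries (K := C_AbsRing) (V := C_NormedModule) c (RtoC r) (f (RtoC r))).
  { apply Heps; split; simpl.
    - change (Rabs (r - 0) < eps); rewrite Rminus_0_r, Rabs_pos_eq; lra.
    - change (Rabs (0 - 0) < eps); rewrite Rminus_0_r, Rabs_R0; lra. }
  unfold is_pseries, is_series in Hser.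
  set (a := fun k => scal (pow_n (K := C_AbsRing) (RtoC r) k) (c k) : C_NormedModule) in Hser.
  assert (Hterm : forall k, Cmod (a k) = r ^ k * Cmod (c k)).
  { intros k; unfold a; change (scal ?x ?y) with (Cmult x y); rewrite Cmod_mult.
    f_equal; induction k as [|k IH]; simpl; [apply Cmod_1|].
    change (mult ?x ?y) with (Cmult x y); rewrite Cmod_mult, IH, Cmod_R, Rabs_pos_eq; lra. }
  (* A term is the difference of two consecutive partial sums. Balls in [C] are products of real
     balls, so radius 1 only gives modulus below [sqrt 2]. *)
  destruct (proj1 (filterlim_locally _ _) Hser (mkposreal 1 Rlt_0_1)) as [N HN].
  destruct (bounded_of_eventually (fun k => Cmod (a k)) (2 * sqrt 2)) as [K HK].
  { exists (S N); intros [|k] Hk; [lia|].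
    assert (H1 : Cmod (minus (sum_n a k) (f (RtoC r))) < sqrt 2 * 1)
      by (apply (C_NormedModule_mixin_compat2 _ _ (mkposreal 1 Rlt_0_1)), HN; lia).
    assert (H2 : Cmod (minus (sum_n a (S k)) (f (RtoC r))) < sqrt 2 * 1)
      by (apply (C_NormedModule_mixin_compat2 _ _ (mkposreal 1 Rlt_0_1)), HN; lia).
    rewrite sum_Sn in H2.
    change (minus ?x ?y) with (x - y)%C in H1, H2.
    change (plus ?x ?y) with (x + y)%C in H2.
    replace (a (S k)) with ((sum_n a k + a (S k) - f (RtoC r)) +
      - (sum_n a k - f (RtoC r)))%C by ring.
    eapply Rle_trans; [apply Cmod_triangle|]; rewrite Cmod_opp; lra. }
  exists K, (/ r); split; [|split].
  - eapply Rle_trans; [apply Cmod_ge_0 | apply (HK 0%nat)].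
  - rewrite <- Rinv_1; apply Rinv_le_contravar; lra.
  - intros k; specialize (HK k); simpl in HK; rewrite Hterm in HK.
    assert (0 < r ^ k) by (apply pow_lt; lra).
    apply Rmult_le_reg_l with (r ^ k); trivial.
    rewrite pow_inv; replace (r ^ k * (K * / r ^ k)) with K by (field; lra); trivial.
Qed.

Lemma uniform_taylor_bound (Lambda : list nat) (a : nat -> C -> C) (c : nat -> fps) :
  (forall j, In j Lambda -> is_taylor_at_0 (a j) (c j)) ->
  exists K B, 0 <= K /\ 1 <= B /\
    forall j, In j Lambda -> forall k, Cmod (c j k) <= K * B ^ k.
Proof.
  induction Lambda as [|j0 L IH]; intros H.
  - exists 0, 1; split; [lra|]; split; [lra|]; intros j [].
  - destruct IH as (K1 & B1 & HK1 & HB1 & H1).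
    { intros j Hj; apply H; now right. }
    destruct (taylor_coefficients_bound _ _ (H j0 (or_introl eq_refl)))
      as (K2 & B2 & HK2 & HB2 & H2).
    exists (K1 + K2), (Rmax B1 B2).
    pose proof (Rmax_l B1 B2); pose proof (Rmax_r B1 B2).
    split; [lra|]; split; [lra|]; intros j [<-|Hj] k.
    + eapply Rle_trans; [apply H2|].
      apply Rmult_le_compat; try lra; [apply pow_le; lra | apply pow_incr; lra].
    + eapply Rle_trans; [now apply H1|].
      apply Rmult_le_compat; try lra; [apply pow_le; lra | apply pow_incr; lra].
Qed.

(** The convolution sum S_n obeys S_(n+1) = B (S_n + K b_n). If S_n <= M A'^n, then b_n <= 2 M A'^n
    and S_(n+1) <= B (1 + 2 K) M A'^n, which dictates the choice of A'. *)
Lemma geometric_gronwall (b : nat -> R) (M A K B : R) :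
  0 <= M -> 0 < A -> 0 <= K -> 0 < B ->
  (forall n, b n <= M * A ^ n + rsum (fun l => K * B ^ (n - l) * b l) (seq 0 n)) ->
  exists A', 0 < A' /\ forall n, b n <= 2 * M * A' ^ n.
Proof.
  intros HM HA HK HB Hb.
  set (A' := Rmax A (B * (1 + 2 * K))).
  assert (HA1 : A <= A') by apply Rmax_l.
  assert (HA2 : B * (1 + 2 * K) <= A') by apply Rmax_r.
  exists A'; split; [lra|].
  assert (Hstep : forall n,
    rsum (fun l => K * B ^ (S n - l) * b l) (seq 0 (S n)) =
    B * (rsum (fun l => K * B ^ (n - l) * b l) (seq 0 n) + K * b n)).
  { intros n; rewrite rsum_seq_S, Rmult_plus_distr_l, <- rsum_mult_l.
    replace (S n - n)%nat with 1%nat by lia; rewrite pow_1.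
    apply f_equal2; [|ring].
    unfold rsum; f_equal; apply map_ext_in; intros l Hl; apply in_seq in Hl.
    replace (S n - l)%nat with (S (n - l)) by lia; simpl; ring. }
  assert (Hboth : forall n,
    rsum (fun l => K * B ^ (n - l) * b l) (seq 0 n) <= M * A' ^ n /\
    b n <= 2 * M * A' ^ n).
  { assert (Hmain : forall n,
      rsum (fun l => K * B ^ (n - l) * b l) (seq 0 n) <= M * A' ^ n ->
      b n <= 2 * M * A' ^ n).
    { intros n Hn; specialize (Hb n).
      assert (M * A ^ n <= M * A' ^ n)
        by (apply Rmult_le_compat_l; trivial; apply pow_incr; lra).
      lra. }
    induction n as [|n [IH1 IH2]]; split.
    - unfold rsum; simpl; lra.
    - apply Hmain; unfold rsum; simpl; lra.
    - rewrite Hstep.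
      apply Rle_trans with (B * (M * A' ^ n + K * (2 * M * A' ^ n))).
      + apply Rmult_le_compat_l; [lra|].
        apply Rplus_le_compat; trivial; now apply Rmult_le_compat_l.
      + replace (B * (M * A' ^ n + K * (2 * M * A' ^ n)))
          with (M * (B * (1 + 2 * K) * A' ^ n)) by ring.
        simpl; apply Rmult_le_compat_l; trivial.
        apply Rmult_le_compat_r; trivial; apply pow_le; lra.
    - apply Hmain; rewrite Hstep.
      apply Rle_trans with (B * (M * A' ^ n + K * (2 * M * A' ^ n))).
      + apply Rmult_le_compat_l; [lra|].
        apply Rplus_le_compat; trivial; now apply Rmult_le_compat_l.
      + replace (B * (M * A' ^ n + K * (2 * M * A' ^ n)))
          with (M * (B * (1 + 2 * K) * A' ^ n)) by ring.
        simpl; apply Rmult_le_compat_l; trivial.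
        apply Rmult_le_compat_r; trivial; apply pow_le; lra. }
  intros n; apply Hboth.
Qed.

Lemma INR_S_le_pow2 n : INR (S n) <= 2 ^ n.
Proof.
  induction n as [|n IH]; [simpl; lra|].
  rewrite S_INR; simpl pow; pose proof (pos_INR n).
  assert (1 <= INR (S n)) by (apply (le_INR 1); lia); lra.
Qed.

Section GevreyOperator.

Context (p : nat) (Lambda : list nat) (c : nat -> fps) (alpha : nat -> nat).
Context (K B : R).
Hypothesis hLambda : NoDup Lambda.
Hypothesis hmax : forall j, In j Lambda -> (j <= p)%nat.
Hypothesis halpha : forall j, In j Lambda -> is_order (c j) (alpha j).
Hypothesis hm : lower_ordinate Lambda alpha = 0%Z.
Hypothesis hK : 0 <= K.
Hypothesis hB : 1 <= B.
Hypothesis hKB : forall j, In j Lambda -> forall k, Cmod (c j k) <= K * B ^ k.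

Lemma Cmod_entry_le j n l :
  In j Lambda -> Cmod (entry c j n l) <= K * B ^ (n + j - l) * INR l ^ j.
Proof.
  intros Hj; unfold entry; rewrite Cmod_mult.
  apply Rmult_le_compat; trivial using Cmod_ge_0, Cmod_falling_le.
  destruct (Nat.leb_spec l (n + j)); [now apply hKB|].
  rewrite Cmod_0; apply Rmult_le_pos; [trivial | apply pow_le; lra].
Qed.

Lemma Cmod_entry_le_lower j n l :
  In j Lambda -> (l <= n)%nat ->
  Cmod (entry c j n l) <= K * B ^ p * B ^ (n - l) * INR l ^ j.
Proof.
  intros Hj Hl; eapply Rle_trans; [now apply Cmod_entry_le|].
  apply Rmult_le_compat_r; [apply pow_le, pos_INR|].
  rewrite Rmult_assoc, <- pow_add; apply Rmult_le_compat_l; trivial.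
  apply Rle_pow; trivial; specialize (hmax j Hj); lia.
Qed.

(** Since no derivative outweighs the zero of its coefficient, row [n] involves only [phi l] with
    [l <= n]. Differentiation then costs a power of [n + 1], which a geometric factor absorbs. *)
Lemma diff_op_fact_gevrey s phi :
  0 <= s -> fact_gevrey s phi -> fact_gevrey s (diff_op Lambda c phi).
Proof.
  intros Hs (M & A & HM & HA & Hphi).
  set (L := INR (length Lambda)).
  assert (HL : 0 <= L) by apply pos_INR.
  set (A1 := Rmax A 1).
  assert (HA1 : A <= A1) by apply Rmax_l.
  assert (HA2 : 1 <= A1) by apply Rmax_r.
  assert (HBp : 0 < B ^ p) by (apply pow_lt; lra).
  (* The [+ 1] ensures positivity. In [2 ^ S p], [p] factors come from the falling factorials and
     one from the number of terms of the row, each through [INR_S_le_pow2]. *)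
  exists (L * (K * B ^ p * M) + 1), (2 ^ S p * (B * A1)).
  assert (HLK : 0 <= L * (K * B ^ p * M)).
  { apply Rmult_le_pos; trivial; apply Rmult_le_pos; [|lra].
    apply Rmult_le_pos; lra. }
  split; [lra|]; split.
  { apply Rmult_lt_0_compat; [apply pow_lt; lra|apply Rmult_lt_0_compat; lra]. }
  intros n; pose proof (fact_power_pos s n) as Hfp.
  set (Q := K * B ^ p * M * INR (S n) ^ p * (B * A1) ^ n * fact_power s n).
  assert (Hterm : forall l j, In j Lambda -> (l <= n)%nat ->
    Cmod (entry c j n l) * Cmod (phi l) <= Q).
  { intros l j Hj Hl.
    apply Rle_trans with
      ((K * B ^ p * B ^ n * INR (S n) ^ p) * (M * A1 ^ n * fact_power s n)).
    - apply Rmult_le_compat; try apply Cmod_ge_0.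
      + eapply Rle_trans; [now apply Cmod_entry_le_lower|].
        apply Rmult_le_compat; [| | |].
        * apply Rmult_le_pos; [apply Rmult_le_pos; lra | apply pow_le; lra].
        * apply pow_le, pos_INR.
        * apply Rmult_le_compat_l; [apply Rmult_le_pos; lra|].
          apply Rle_pow; trivial; lia.
        * apply Rle_trans with (INR (S n) ^ j).
          -- apply pow_incr; split; [apply pos_INR | apply le_INR; lia].
          -- apply Rle_pow; [apply (le_INR 1); lia | now apply hmax].
      + eapply Rle_trans; [apply Hphi|].
        apply Rmult_le_compat; [| |apply Rmult_le_compat_l; [lra|]|].
        * apply Rmult_le_pos; [lra | apply pow_le; lra].
        * left; apply fact_power_pos.
        * apply Rle_trans with (A1 ^ l); [apply pow_incr; lra|].
          apply Rle_pow; trivial.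
        * now apply fact_power_le.
    - unfold Q; rewrite (Rpow_mult_distr B A1); right; ring. }
  rewrite (diff_op_triangular p Lambda c alpha hmax halpha) by exact hm.
  rewrite <- (op_matrix_diag Lambda c alpha halpha n n) by lia.
  rewrite <- (csum_seq_S (fun l => op_matrix Lambda c n l * phi l)%C).
  eapply Rle_trans; [apply Cmod_csum_le|].
  apply Rle_trans with (rsum (fun _ : nat => L * Q) (seq 0 (S n))).
  - apply rsum_le; intros l Hl; apply in_seq in Hl.
    rewrite Cmod_mult, Rmult_comm.
    eapply Rle_trans;
      [apply Rmult_le_compat_l; [apply Cmod_ge_0 | apply Cmod_csum_le]|].
    rewrite <- rsum_mult_l; unfold L; rewrite <- rsum_const.
    apply rsum_le; intros j Hj; rewrite Rmult_comm; apply Hterm; trivial; lia.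
  - rewrite rsum_const, length_seq; unfold Q.
    replace (INR (S n) * (L * (K * B ^ p * M * INR (S n) ^ p * (B * A1) ^ n *
      fact_power s n)))
      with (L * (K * B ^ p * M) * (INR (S n) ^ S p * (B * A1) ^ n * fact_power s n))
      by (simpl; ring).
    rewrite (Rmult_assoc (L * _ + 1)).
    assert (H1 : INR (S n) ^ S p * (B * A1) ^ n * fact_power s n <=
                 (2 ^ S p * (B * A1)) ^ n * fact_power s n).
    { apply Rmult_le_compat_r; [lra|].
      rewrite (Rpow_mult_distr (2 ^ S p)); apply Rmult_le_compat_r;
        [apply pow_le, Rmult_le_pos; lra|].
      rewrite <- pow_mult, Nat.mul_comm, pow_mult.
      apply pow_incr; split; [apply pos_INR | apply INR_S_le_pow2]. }
    assert (0 <= INR (S n) ^ S p * (B * A1) ^ n * fact_power s n).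
    { apply Rmult_le_pos; [|lra]; apply Rmult_le_pos; apply pow_le;
        [apply pos_INR | apply Rmult_le_pos; lra]. }
    apply Rmult_le_compat; trivial; lra.
Qed.

(** After division of row [n] by W_0(n) n!^s, the normalized moduli [b n] of the coefficients
    satisfy the hypothesis of [geometric_gronwall]. *)
Lemma fact_gevrey_of_diff_op s J f :
  0 <= s -> In J Lambda -> alpha J = J ->
  (forall j, In j Lambda -> alpha j = j -> (j <= J)%nat) ->
  (forall n, char_poly Lambda c alpha (lower_ordinate Lambda alpha)
               (RtoC (INR n)) <> 0%C) ->
  (forall j, In j Lambda -> INR j - INR J <= s * (INR (alpha j) - INR j)) ->
  fact_gevrey s (diff_op Lambda c f) -> fact_gevrey s f.
Proof.
  intros Hs HJ HJ0 HJmax HW Hc (M & A & HM & HA & Hg).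
  set (L := INR (length Lambda)); assert (HL : 0 <= L) by apply pos_INR.
  assert (HBp : 0 < B ^ p) by (apply pow_lt; lra).
  set (W := fun n => char_poly Lambda c alpha (lower_ordinate Lambda alpha)
                       (RtoC (INR n))).
  (* Every row is divided by this bound, including row 0, hence [S n] in place of [n]. The change
     costs [(/ 2) ^ J], as [n >= (n + 1) / 2] for [n >= 1]; non-resonance covers the finitely many
     small rows. *)
  assert (Hkappa : exists kappa, 0 < kappa /\
    forall n, kappa * INR (S n) ^ J <= Cmod (W n)).
  { destruct (char_poly_lower_bound Lambda c alpha hLambda halpha J)
      as (kappa & Hk & N & HN); trivial.
    { rewrite hm; unfold ordinate; lia. }
    { intros j Hj E; apply HJmax; trivial; rewrite hm in E; unfold ordinate in E; lia. }
    apply (lower_bound_of_eventually _ _ (kappa * (/ 2) ^ J)).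
    - apply Rmult_lt_0_compat; [trivial | apply pow_lt; lra].
    - intros n; apply Cmod_gt_0, HW.
    - intros n; apply pow_le, pos_INR.
    - exists (S N); intros n Hn; eapply Rle_trans; [|apply HN; lia].
      rewrite Rmult_assoc, <- Rpow_mult_distr.
      apply Rmult_le_compat_l; [lra|]; apply pow_incr; rewrite S_INR.
      assert (1 <= INR n) by (apply (le_INR 1); lia); lra. }
  destruct Hkappa as (kappa & Hk & HWk).
  assert (Hentry : forall n l j, In j Lambda -> (l < n)%nat ->
    Cmod (entry c j n l) * fact_power s l <=
    K * B ^ p * B ^ (n - l) * INR (S n) ^ J * fact_power s n).
  { intros n l j Hj Hl.
    assert (HKB : 0 <= K * B ^ p * B ^ (n - l)).
    { apply Rmult_le_pos; [apply Rmult_le_pos; lra | apply pow_le; lra]. }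
    assert (Hn1 : 1 <= INR (S n)) by (apply (le_INR 1); lia).
    assert (Hl1 : 1 <= INR (S l)) by (apply (le_INR 1); lia).
    pose proof (fact_power_pos s l) as Hfl; pose proof (fact_power_pos s n) as Hfn.
    destruct (le_lt_dec (l + alpha j) (n + j)) as [Hge|Hlt].
    2: { rewrite (entry_0 Lambda c alpha halpha), Cmod_0, Rmult_0_l by trivial.
         apply Rmult_le_pos; [|lra]; apply Rmult_le_pos; trivial; apply pow_le; lra. }
    eapply Rle_trans;
      [apply Rmult_le_compat_r; [lra | apply Cmod_entry_le_lower; trivial; lia]|].
    rewrite !(Rmult_assoc (K * B ^ p * B ^ (n - l))); apply Rmult_le_compat_l; trivial.
    assert (Hlj : INR l ^ j <= INR (S l) ^ j)
      by (apply pow_incr; split; [apply pos_INR | apply le_INR; lia]).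
    apply Rle_trans with (INR (S l) ^ j * fact_power s l);
      [apply Rmult_le_compat_r; lra|].
    (* For [j <= J] the power is covered by the growth of W_0. For [j > J] the excess [j - J] is at
       most s (alpha j - j) <= s (n - l), and the ratio of factorial powers pays for it. *)
    destruct (le_lt_dec j J) as [HjJ|HjJ].
    - apply Rmult_le_compat; try lra; [apply pow_le; lra| |apply fact_power_le; trivial; lia].
      apply Rle_trans with (INR (S n) ^ j); [|now apply Rle_pow].
      apply pow_incr; split; [lra | apply le_INR; lia].
    - replace j with (J + (j - J))%nat by lia; rewrite pow_add, Rmult_assoc.
      apply Rmult_le_compat; [apply pow_le; lra| | |].
      + apply Rmult_le_pos; [apply pow_le; lra | lra].
      + apply pow_incr; split; [lra | apply le_INR; lia].
      + rewrite <- Rpower_pow by lra; apply fact_power_ratio; trivial; [lia|].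
        rewrite minus_INR by lia; eapply Rle_trans; [now apply Hc|].
        apply Rmult_le_compat_l; trivial.
        apply le_INR in Hge; rewrite !plus_INR in Hge; lra. }
  set (b := fun n => Cmod (f n) / fact_power s n).
  destruct (geometric_gronwall b (M / kappa) A (L * (K * B ^ p) / kappa) B)
    as (A' & HA' & Hb); trivial; try lra.
  { apply Rdiv_le_0_compat; lra. }
  { apply Rdiv_le_0_compat; trivial; apply Rmult_le_pos; trivial;
      apply Rmult_le_pos; lra. }
  { intros n; pose proof (fact_power_pos s n) as Hfn.
    assert (Hn1 : 1 <= INR (S n) ^ J) by (apply pow_R1_Rle, (le_INR 1); lia).
    assert (Hrow : Cmod (W n) * Cmod (f n) <=
      M * A ^ n * fact_power s n +
      rsum (fun l => L * (K * B ^ p) * B ^ (n - l) * INR (S n) ^ J *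
                     fact_power s n * b l) (seq 0 n)).
    { pose proof (diff_op_triangular p Lambda c alpha hmax halpha f n hm) as E.
      fold (W n) in E.
      rewrite <- Cmod_mult.
      replace (W n * f n)%C with (diff_op Lambda c f n +
        - csum (fun l => op_matrix Lambda c n l * f l) (seq 0 n))%C
        by (rewrite E; ring).
      eapply Rle_trans; [apply Cmod_triangle|]; rewrite Cmod_opp.
      apply Rplus_le_compat; [apply Hg|].
      eapply Rle_trans; [apply Cmod_csum_le|]; apply rsum_le; intros l Hl.
      apply in_seq in Hl; rewrite Cmod_mult; pose proof (fact_power_pos s l) as Hfl.
      replace (Cmod (f l)) with (fact_power s l * b l)
        by (unfold b; field; lra).
      rewrite <- Rmult_assoc; apply Rmult_le_compat_r.
      { apply Rdiv_le_0_compat; [apply Cmod_ge_0 | trivial]. }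
      rewrite Rmult_comm.
      eapply Rle_trans; [apply Rmult_le_compat_l; [lra | apply Cmod_csum_le]|].
      rewrite <- rsum_mult_l.
      replace (L * (K * B ^ p) * B ^ (n - l) * INR (S n) ^ J * fact_power s n)
        with (L * (K * B ^ p * B ^ (n - l) * INR (S n) ^ J * fact_power s n)) by ring.
      unfold L; rewrite <- rsum_const; apply rsum_le; intros j Hj.
      rewrite Rmult_comm; apply Hentry; trivial; lia. }
    assert (Hkn : 0 < kappa * INR (S n) ^ J * fact_power s n).
    { apply Rmult_lt_0_compat; trivial; apply Rmult_lt_0_compat; lra. }
    apply Rmult_le_reg_l with (kappa * INR (S n) ^ J * fact_power s n); trivial.
    apply Rle_trans with (Cmod (W n) * Cmod (f n)).
    - unfold b; replace (_ * (Cmod (f n) / fact_power s n))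
        with (kappa * INR (S n) ^ J * Cmod (f n)) by (field; lra).
      apply Rmult_le_compat_r; [apply Cmod_ge_0 | apply HWk].
    - eapply Rle_trans; [exact Hrow|].
      rewrite Rmult_plus_distr_l, <- rsum_mult_l; apply Rplus_le_compat.
      + replace (kappa * INR (S n) ^ J * fact_power s n * (M / kappa * A ^ n))
          with (INR (S n) ^ J * (M * A ^ n * fact_power s n)) by (field; lra).
        rewrite <- (Rmult_1_l (M * A ^ n * fact_power s n)) at 1.
        apply Rmult_le_compat_r; trivial; apply Rmult_le_pos; [|lra].
        apply Rmult_le_pos; [lra | apply pow_le; lra].
      + apply rsum_le; intros l _; right; field; lra. }
  exists (2 * (M / kappa)), A'; split; [|split; trivial].
  { apply Rmult_lt_0_compat; [lra|now apply Rdiv_lt_0_compat]. }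
  intros n; specialize (Hb n); pose proof (fact_power_pos s n) as Hfn.
  replace (Cmod (f n)) with (b n * fact_power s n) by (unfold b; field; lra).
  apply Rmult_le_compat_r; lra.
Qed.

End GevreyOperator.

(** * Necessity of the slope condition *)

(** The two exponents are affine in the parameter. If they agree at [s], their slopes differ,
    because equal values and equal slopes would give [a = b]; so the order is strict just to the
    right of [s]. *)
Lemma exponent_comparison (d : nat -> nat) (s : R) (a b : nat) :
  a <> b ->
  exists eps0, 0 < eps0 /\
    ((forall eps, 0 < eps < eps0 ->
        INR a - (s + eps) * INR (d a) < INR b - (s + eps) * INR (d b)) \/
     (forall eps, 0 < eps < eps0 ->
        INR b - (s + eps) * INR (d b) < INR a - (s + eps) * INR (d a))).
Proof.
  assert (Hstrict : forall a b, INR a - s * INR (d a) < INR b - s * INR (d b) ->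
    exists eps0, 0 < eps0 /\ forall eps, 0 < eps < eps0 ->
        INR a - (s + eps) * INR (d a) < INR b - (s + eps) * INR (d b)).
  { clear a b; intros a b H; pose proof (pos_INR (d a)); pose proof (pos_INR (d b)).
    set (D := (INR b - s * INR (d b)) - (INR a - s * INR (d a))).
    exists (D / (INR (d b) + 1)); split; [apply Rdiv_lt_0_compat; unfold D; lra|].
    intros eps [He1 He2].
    apply Rmult_lt_compat_r with (r := INR (d b) + 1) in He2; [|lra].
    unfold Rdiv in He2; rewrite Rmult_assoc, Rinv_l, Rmult_1_r in He2 by lra.
    unfold D in He2; nra. }
  intros Hab.
  destruct (Rtotal_order (INR a - s * INR (d a)) (INR b - s * INR (d b)))
    as [H|[H|H]].
  - destruct (Hstrict a b H) as (e & He & Hlt); exists e; tauto.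
  - exists 1; split; [lra|].
    destruct (Nat.lt_trichotomy (d a) (d b)) as [Hd|[Hd|Hd]].
    + right; intros eps He; apply lt_INR in Hd; nra.
    + exfalso; apply Hab, INR_eq; rewrite Hd in H; lra.
    + left; intros eps He; apply lt_INR in Hd; nra.
  - destruct (Hstrict b a H) as (e & He & Hlt); exists e; tauto.
Qed.

Lemma dominant_exponent (d : nat -> nat) (s : R) (l : list nat) :
  l <> [] ->
  exists j1 eps0, In j1 l /\ 0 < eps0 /\
    forall eps, 0 < eps < eps0 -> forall j, In j l -> j <> j1 ->
      INR j - (s + eps) * INR (d j) < INR j1 - (s + eps) * INR (d j1).
Proof.
  induction l as [|a l IH]; intros Hl; [contradiction|].
  destruct l as [|b l].
  { exists a, 1; split; [now left|]; split; [lra|].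
    intros eps _ j [->|[]] Hj; contradiction. }
  destruct IH as (j1 & e1 & Hj1 & He1 & H1); [discriminate|].
  destruct (Nat.eq_dec a j1) as [->|Ha].
  { exists j1, e1; split; [now left|]; split; trivial.
    intros eps He j [->|Hj] Hne; [contradiction|]; now apply H1. }
  destruct (exponent_comparison d s a j1 Ha) as (e2 & He2 & [H2|H2]).
  - exists j1, (Rmin e1 e2); split; [now right|]; split; [now apply Rmin_glb_lt|].
    intros eps He j Hj Hne.
    pose proof (Rmin_l e1 e2); pose proof (Rmin_r e1 e2).
    destruct Hj as [<-|Hj]; [apply H2 | apply H1]; trivial; lra.
  - exists a, (Rmin e1 e2); split; [now left|]; split; [now apply Rmin_glb_lt|].
    intros eps He j Hj Hne.
    pose proof (Rmin_l e1 e2); pose proof (Rmin_r e1 e2).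
    destruct Hj as [->|Hj]; [contradiction|].
    assert (Hb : INR j1 - (s + eps) * INR (d j1) < INR a - (s + eps) * INR (d a))
      by (apply H2; lra).
    destruct (Nat.eq_dec j j1) as [->|Hj']; trivial.
    eapply Rlt_trans; [apply H1; trivial; lra | exact Hb].
Qed.

Definition weight (A t : R) (l : nat) : R := A ^ l * fact_power t l.

Lemma weight_pos A t l : 0 < A -> 0 < weight A t l.
Proof.
  intros HA; apply Rmult_lt_0_compat; [now apply pow_lt | apply fact_power_pos].
Qed.

Lemma fact_le_pow_sub d n : (d <= n)%nat -> INR (fact n) <= INR n ^ d * INR (fact (n - d)).
Proof.
  intros Hd; rewrite <- pow_INR, <- mult_INR; apply le_INR.
  induction d as [|d IH]; [rewrite Nat.sub_0_r; simpl; lia|].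
  eapply Nat.le_trans; [apply IH; lia|].
  replace (n - d)%nat with (S (n - S d)) by lia.
  change (fact (S (n - S d))) with (S (n - S d) * fact (n - S d))%nat.
  rewrite Nat.mul_assoc; apply Nat.mul_le_mono_r.
  rewrite Nat.pow_succ_r', Nat.mul_comm; apply Nat.mul_le_mono_r; lia.
Qed.

Lemma Rpower_neg_small (delta eta : R) :
  0 < delta -> 0 < eta -> eventually (fun n => Rpower (INR n) (- delta) <= eta).
Proof.
  intros Hd He.
  destruct (INR_unbounded (exp (- ln eta / delta))) as [N HN].
  exists N; intros n Hn; apply le_INR in Hn.
  assert (Hx : - ln eta / delta < ln (INR n)).
  { rewrite <- (ln_exp (- ln eta / delta)); apply ln_increasing; [apply exp_pos|lra]. }
  apply Rmult_lt_compat_l with (r := delta) in Hx; trivial.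
  replace (delta * (- ln eta / delta)) with (- ln eta) in Hx by (field; lra).
  rewrite <- (exp_ln eta) by trivial; unfold Rpower.
  left; apply exp_increasing; lra.
Qed.

(** Up to constants, lowering the index of a weight by [D] divides it by n^(t D), so the quotient of
    the two sides is of order n^(-delta). *)
Lemma weight_ratio_small (A t : R) (j D j1 d1 : nat) (eta : R) :
  0 < A -> 0 <= t -> INR j - t * INR D < INR j1 - t * INR d1 -> 0 < eta ->
  eventually (fun n =>
    INR n ^ j * weight A t (n - D) <= eta * (INR n ^ j1 * weight A t (n - d1))).
Proof.
  intros HA Ht Hlt Heta.
  set (delta := (INR j1 - t * INR d1) - (INR j - t * INR D)).
  (* The power of 1/2 comes from [n - D + 1 >= n / 2], the powers of [A] from the geometric parts of
     the weights. *)
  set (C1 := Rpower (/ 2) (t * INR D) * A ^ D / A ^ d1).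
  assert (HC1 : 0 < C1).
  { apply Rdiv_lt_0_compat; [|now apply pow_lt].
    apply Rmult_lt_0_compat; [apply exp_pos | now apply pow_lt]. }
  destruct (Rpower_neg_small delta (eta * C1)) as [N HN].
  { unfold delta; lra. }
  { now apply Rmult_lt_0_compat. }
  exists (N + 2 * D + d1 + 1)%nat; intros n Hn.
  assert (Hn1 : 1 <= INR n) by (apply (le_INR 1); lia).
  assert (Hn0 : 0 < INR n) by lra.
  specialize (HN n ltac:(lia)).
  assert (Hup : Rpower (INR n / 2) (t * INR D) * fact_power t (n - D) <= fact_power t n).
  { eapply Rle_trans; [|apply (fact_power_ratio t (t * INR D) (n - D) n Ht); [lia|]].
    - apply Rmult_le_compat_r; [left; apply fact_power_pos|].
      apply Rle_Rpower_l; [apply Rmult_le_pos; trivial using pos_INR|].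
      split; [lra|]; rewrite S_INR, minus_INR by lia.
      assert (2 * INR D <= INR n)
        by (change 2 with (INR 2); rewrite <- mult_INR; apply le_INR; lia).
      lra.
    - rewrite minus_INR by lia; right; ring. }
  assert (Hlow : fact_power t n <= Rpower (INR n) (t * INR d1) * fact_power t (n - d1)).
  { unfold fact_power; rewrite (Rmult_comm t), <- Rpower_mult, Rpower_pow by trivial.
    rewrite Rpower_mult_distr by (apply INR_fact_lt_0 || now apply pow_lt).
    apply Rle_Rpower_l; trivial; split; [apply INR_fact_lt_0|].
    apply fact_le_pow_sub; lia. }
  assert (Hhalf : Rpower (INR n / 2) (t * INR D) =
                  Rpower (INR n) (t * INR D) * Rpower (/ 2) (t * INR D)).
  { rewrite Rpower_mult_distr by lra; reflexivity. }
  assert (HAn : A ^ (n - d1) = A ^ n / A ^ d1).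
  { replace n with (n - d1 + d1)%nat at 2 by lia; rewrite pow_add.
    field; apply pow_nonzero; lra. }
  assert (HAD : A ^ (n - D) = A ^ n / A ^ D).
  { replace n with (n - D + D)%nat at 2 by lia; rewrite pow_add.
    field; apply pow_nonzero; lra. }
  assert (Hexp : INR n ^ j * Rpower (INR n) (t * INR d1) =
    Rpower (INR n) (- delta) * (INR n ^ j1 * Rpower (INR n) (t * INR D))).
  { rewrite <- !Rpower_pow, <- !Rpower_plus by trivial; f_equal; unfold delta; ring. }
  pose proof (fact_power_pos t (n - D)) as HfD.
  pose proof (fact_power_pos t (n - d1)) as Hfd.
  pose proof (pow_lt A n HA) as HA1; pose proof (pow_lt A D HA) as HA2.
  pose proof (pow_lt A d1 HA) as HA3.
  unfold weight; rewrite HAn, HAD.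
  set (q := Rpower (/ 2) (t * INR D)) in *; assert (Hq : 0 < q) by apply exp_pos.
  set (u := Rpower (INR n) (t * INR D)) in *; assert (Hu : 0 < u) by apply exp_pos.
  set (v := Rpower (INR n) (t * INR d1)) in *; assert (Hv : 0 < v) by apply exp_pos.
  pose proof (pow_lt (INR n) j Hn0) as Hnj; pose proof (pow_lt (INR n) j1 Hn0) as Hnj1.
  assert (H1 : u * q * fact_power t (n - D) <= v * fact_power t (n - d1))
    by (rewrite <- Hhalf; lra).
  assert (H2 : INR n ^ j * v <= eta * C1 * (INR n ^ j1 * u)).
  { rewrite Hexp; apply Rmult_le_compat_r; trivial.
    left; now apply Rmult_lt_0_compat. }
  apply Rmult_le_reg_l with (u * q * A ^ D / A ^ n).
  { apply Rdiv_lt_0_compat; trivial; apply Rmult_lt_0_compat; trivial.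
    now apply Rmult_lt_0_compat. }
  replace (u * q * A ^ D / A ^ n * (INR n ^ j * (A ^ n / A ^ D * fact_power t (n - D))))
    with (INR n ^ j * (u * q * fact_power t (n - D))) by (field; lra).
  apply Rle_trans with (INR n ^ j * (v * fact_power t (n - d1)));
    [apply Rmult_le_compat_l; lra|].
  replace (u * q * A ^ D / A ^ n * (eta * (INR n ^ j1 *
             (A ^ n / A ^ d1 * fact_power t (n - d1)))))
    with (eta * C1 * (INR n ^ j1 * u) * fact_power t (n - d1))
    by (unfold C1; field; lra).
  rewrite <- Rmult_assoc; apply Rmult_le_compat_r; lra.
Qed.

(** The rate of [f] may exceed [A]: the inequality u^l <= l! e^u, raised to the power [t - s] with
    [u] chosen so that u^(t - s) = A0 / A, absorbs the quotient of the rates in l!^(t - s). *)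
Lemma fact_gevrey_weight_bound (s t A : R) (f : fps) :
  s < t -> 0 < A -> fact_gevrey s f ->
  exists M, forall l, Cmod (f l) <= M * weight A t l.
Proof.
  intros Hst HA (M & A0 & HM & HA0 & Hf).
  set (delta := t - s); assert (Hd : 0 < delta) by (unfold delta; lra).
  set (u := Rpower (A0 / A) (/ delta)); assert (Hu : 0 < u) by apply exp_pos.
  assert (Hq : 0 < A0 / A) by now apply Rdiv_lt_0_compat.
  exists (M * Rpower (exp u) delta); intros l.
  eapply Rle_trans; [apply Hf|]; unfold weight.
  pose proof (pow_le_fact_exp u l (Rlt_le _ _ Hu)) as H.
  apply (fun H => Rle_Rpower_l _ _ delta (Rlt_le _ _ Hd) (conj (pow_lt _ l Hu) H)) in H.
  rewrite <- (Rpower_pow l), Rpower_mult in H by trivial.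
  rewrite <- Rpower_mult_distr in H by (apply INR_fact_lt_0 || apply exp_pos).
  unfold u at 1 in H; rewrite Rpower_mult in H.
  replace (/ delta * (INR l * delta)) with (INR l) in H by (field; lra).
  rewrite Rpower_pow in H by trivial; fold (fact_power delta l) in H.
  assert (E : fact_power t l = fact_power delta l * fact_power s l).
  { unfold fact_power; rewrite <- Rpower_plus; f_equal; unfold delta; ring. }
  assert (E0 : A0 ^ l = A ^ l * (A0 / A) ^ l)
    by (rewrite <- Rpow_mult_distr; f_equal; field; lra).
  rewrite E, E0.
  replace (M * (A ^ l * (A0 / A) ^ l) * fact_power s l)
    with (M * A ^ l * fact_power s l * (A0 / A) ^ l) by ring.
  replace (M * Rpower (exp u) delta * (A ^ l * (fact_power delta l * fact_power s l)))
    with (M * A ^ l * fact_power s l * (fact_power delta l * Rpower (exp u) delta)) by ring.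
  apply Rmult_le_compat_l; trivial.
  apply Rmult_le_pos; [|left; apply fact_power_pos].
  apply Rmult_le_pos; [lra | apply pow_le; lra].
Qed.

Lemma rsum_pow2_le (m k : nat) :
  rsum (fun l => if (l <=? m)%nat then 2 ^ l else 0) (seq 0 k) <= 2 * 2 ^ m.
Proof.
  enough (H : rsum (fun l => if (l <=? m)%nat then 2 ^ l else 0) (seq 0 k)
              <= 2 ^ Nat.min k (S m)).
  { eapply Rle_trans; [exact H|]; change (2 * 2 ^ m) with (2 ^ S m).
    apply Rle_pow; [lra|lia]. }
  induction k as [|k IH]; [unfold rsum; simpl; lra|].
  rewrite rsum_seq_S; destruct (Nat.leb_spec k m).
  - rewrite Nat.min_l in * by lia; simpl; lra.
  - rewrite Nat.min_r in * by lia; lra.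
Qed.

Lemma eventually_rsum_le (u : nat -> nat -> R) (v : nat -> R) (l : list nat) :
  (forall j, In j l -> forall eta, 0 < eta -> eventually (fun n => u j n <= eta * v n)) ->
  forall eta, 0 < eta -> eventually (fun n => 0 <= v n) ->
  eventually (fun n => rsum (fun j => u j n) l <= eta * v n).
Proof.
  induction l as [|j l IH]; intros H eta Heta Hv.
  - revert Hv; apply filter_imp; intros n Hn; unfold rsum; simpl.
    apply Rmult_le_pos; lra.
  - assert (H1 : eventually (fun n => u j n <= eta / 2 * v n))
      by (apply H; [now left|lra]).
    assert (H2 : eventually (fun n => rsum (fun j => u j n) l <= eta / 2 * v n)).
    { apply IH; trivial; [|lra]; intros i Hi; apply H; now right. }
    generalize (filter_and _ _ H1 H2); apply filter_imp; intros n [Hn1 Hn2].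
    rewrite rsum_cons; lra.
Qed.

Section SlopeNecessity.

Context (p : nat) (Lambda : list nat) (c : nat -> fps) (alpha : nat -> nat).
Context (K B : R).
Hypothesis hLambda : NoDup Lambda.
Hypothesis hmax : forall j, In j Lambda -> (j <= p)%nat.
Hypothesis halpha : forall j, In j Lambda -> is_order (c j) (alpha j).
Hypothesis hm : lower_ordinate Lambda alpha = 0%Z.
Hypothesis hK : 0 <= K.
Hypothesis hB : 1 <= B.
Hypothesis hKB : forall j, In j Lambda -> forall k, Cmod (c j k) <= K * B ^ k.

Lemma order_ge j : In j Lambda -> (j <= alpha j)%nat.
Proof.
  intros Hj; pose proof (lower_ordinate_le Lambda alpha j Hj) as H.
  rewrite hm in H; unfold ordinate in H; lia.
Qed.

Section Dominant.

(* On the weighted space, row [n] is dominated for large [n] by its entry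
   of index [n - d1] coming from [j1]. *)
Context (t : R) (j1 : nat).
Hypothesis ht : 0 < t.
Hypothesis hj1 : In j1 Lambda.
Let d j := (alpha j - j)%nat.
Let d1 := d j1.
Let w := weight (2 * B) t.
Hypothesis hdom : forall j, In j Lambda -> j <> j1 ->
  INR j - t * INR (d j) < INR j1 - t * INR d1.

Let leading j n l := andb (j =? j1)%nat (l =? n - d1)%nat.
Let rest j n l : C := if leading j n l then 0%C else entry c j n l.

(** These entries vanish for [l > n - D]. Since B^(n - l) (2B)^l = B^n 2^l, the sum is at most twice
    its bound at [l = n - D], and [weight_ratio_small] applies. *)
Lemma rest_entries_small j eta :
  In j Lambda -> 0 < eta ->
  eventually (fun n =>
    rsum (fun l => Cmod (rest j n l) * w l) (seq 0 (S n)) <=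
    eta * (INR n ^ j1 * w (n - d1))).
Proof.
  intros Hj Heta.
  (* For [j = j1] the leading entry has been removed, so the next shift is [d1 + 1]; the exponent
     then drops by [t > 0]. *)
  set (D := if (j =? j1)%nat then S d1 else d j).
  assert (HD : INR j - t * INR D < INR j1 - t * INR d1).
  { unfold D; destruct (Nat.eqb_spec j j1) as [->|Hne]; [|now apply hdom].
    rewrite S_INR; lra. }
  set (C1 := 2 * (K * B ^ p) * B ^ D + 1).
  assert (HBp : 0 < B ^ p) by (apply pow_lt; lra).
  assert (HBD : 0 < B ^ D) by (apply pow_lt; lra).
  assert (HKB0 : 0 <= K * B ^ p) by (apply Rmult_le_pos; lra).
  assert (HC1 : 0 < C1).
  { unfold C1; assert (0 <= K * B ^ p * B ^ D) by (apply Rmult_le_pos; lra); lra. }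
  destruct (weight_ratio_small (2 * B) t j D j1 d1 (eta / C1)) as [N HN]; trivial;
    try lra; [now apply Rdiv_lt_0_compat|].
  exists (N + D + d1)%nat; intros n Hn.
  specialize (HN n ltac:(lia)); fold w in HN.
  assert (Hzero : forall l, (n - D < l)%nat -> (l <= n)%nat -> rest j n l = 0%C).
  { intros l Hl Hln; unfold rest, leading.
    destruct (andb _ _) eqn:E; trivial.
    apply (entry_0 Lambda c alpha halpha); trivial.
    pose proof (order_ge j Hj); unfold D, d1, d in *.
    destruct (Nat.eqb_spec j j1) as [->|Hne]; [|lia].
    simpl in E; apply Nat.eqb_neq in E; lia. }
  assert (Hw0 : 0 < w (n - D)) by (apply weight_pos; lra).
  set (Q := K * B ^ p * INR n ^ j * B ^ n * fact_power t (n - D)).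
  assert (HQ : 0 <= Q).
  { pose proof (pos_INR n) as Hn0; unfold Q; repeat apply Rmult_le_pos; try lra;
      try (apply pow_le; lra); left; apply fact_power_pos. }
  apply Rle_trans with (Q * (2 * 2 ^ (n - D))).
  - eapply Rle_trans; [|apply Rmult_le_compat_l; [exact HQ|apply (rsum_pow2_le _ (S n))]].
    rewrite <- rsum_mult_l; apply rsum_le; intros l Hl; apply in_seq in Hl.
    destruct (Nat.leb_spec l (n - D)) as [Hle|Hgt].
    2: { rewrite Hzero, Cmod_0 by lia; lra. }
    assert (HB1 : B ^ n = B ^ (n - l) * B ^ l) by (rewrite <- pow_add; f_equal; lia).
    replace (Q * 2 ^ l) with (K * B ^ p * B ^ (n - l) * INR n ^ j *
      ((2 * B) ^ l * fact_power t (n - D)))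
      by (unfold Q; rewrite HB1, Rpow_mult_distr; ring).
    apply Rmult_le_compat; [apply Cmod_ge_0 | left; apply weight_pos; lra | |].
    + unfold rest; destruct (leading j n l).
      { rewrite Cmod_0; apply Rmult_le_pos; [|apply pow_le, pos_INR].
        apply Rmult_le_pos; [lra | apply pow_le; lra]. }
      eapply Rle_trans; [apply (Cmod_entry_le_lower p Lambda c K B); trivial; lia|].
      apply Rmult_le_compat_l.
      * apply Rmult_le_pos; [lra | apply pow_le; lra].
      * apply pow_incr; split; [apply pos_INR | apply le_INR; lia].
    + apply Rmult_le_compat_l; [apply pow_le; lra|].
      apply fact_power_le; [lra|trivial].
  - assert (HB1 : B ^ n = B ^ (n - D) * B ^ D) by (rewrite <- pow_add; f_equal; lia).
    replace (Q * (2 * 2 ^ (n - D)))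
      with (2 * (K * B ^ p) * B ^ D * (INR n ^ j * w (n - D)))
      by (unfold Q, w, weight; rewrite HB1, Rpow_mult_distr; ring).
    apply Rle_trans with (C1 * (INR n ^ j * w (n - D))).
    + apply Rmult_le_compat_r; [|unfold C1; lra].
      apply Rmult_le_pos; [apply pow_le, pos_INR | lra].
    + apply Rmult_le_compat_l with (r := C1) in HN; [|lra].
      eapply Rle_trans; [exact HN|]; right; field; lra.
Qed.

Lemma leading_entry n :
  (d1 <= n)%nat ->
  entry c j1 n (n - d1) =
  (c j1 (alpha j1) * falling (RtoC (INR (n - d1))) j1)%C.
Proof.
  intros Hn; unfold entry; destruct (Nat.leb_spec (n - d1) (n + j1)); [|lia].
  pose proof (order_ge j1 hj1); do 2 f_equal; unfold d1, d in *; lia.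
Qed.

Lemma leading_entry_dominates :
  exists N, (d1 <= N)%nat /\ forall n, (N <= n)%nat ->
    0 < Cmod (entry c j1 n (n - d1)) /\
    rsum (fun j => rsum (fun l => Cmod (rest j n l) * w l) (seq 0 (S n))) Lambda <=
    / 2 * (Cmod (entry c j1 n (n - d1)) * w (n - d1)).
Proof.
  assert (Hc : 0 < Cmod (c j1 (alpha j1))) by (apply Cmod_gt_0, halpha, hj1).
  (* Since [n - d1 >= n / 2], the falling factorial is at least [(n / 4) ^ j1]; the first factor 1/2
     is the contraction constant wanted. *)
  set (eta := / 2 * (Cmod (c j1 (alpha j1)) * (/ 4) ^ j1)).
  assert (Heta : 0 < eta).
  { apply Rmult_lt_0_compat; [lra|]; apply Rmult_lt_0_compat; trivial.
    apply pow_lt; lra. }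
  destruct (eventually_rsum_le
    (fun j n => rsum (fun l => Cmod (rest j n l) * w l) (seq 0 (S n)))
    (fun n => INR n ^ j1 * w (n - d1)) Lambda) with (eta := eta) as [N HN]; trivial.
  { intros j Hj e He; now apply rest_entries_small. }
  { exists 0%nat; intros n _; apply Rmult_le_pos; [apply pow_le, pos_INR|].
    left; apply weight_pos; lra. }
  exists (N + 2 * d1 + 2 * j1 + 1)%nat; split; [lia|]; intros n Hn.
  assert (Hf : (INR n / 4) ^ j1 <= Cmod (falling (RtoC (INR (n - d1))) j1)).
  { eapply Rle_trans; [|apply Cmod_falling_ge; lia].
    assert (2 * INR d1 <= INR n)
      by (change 2 with (INR 2); rewrite <- mult_INR; apply le_INR; lia).
    rewrite minus_INR by lia; pose proof (pos_INR n); apply pow_incr; lra. }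
  assert (Hn0 : 0 < INR n) by (apply lt_0_INR; lia).
  rewrite leading_entry, Cmod_mult by lia; split.
  - apply Rmult_lt_0_compat; trivial; eapply Rlt_le_trans; [|exact Hf].
    apply pow_lt; lra.
  - eapply Rle_trans; [apply HN; lia|]; unfold eta.
    replace (/ 2 * (Cmod (c j1 (alpha j1)) * (/ 4) ^ j1) * (INR n ^ j1 * w (n - d1)))
      with (/ 2 * (Cmod (c j1 (alpha j1)) * (INR n / 4) ^ j1 * w (n - d1)))
      by (unfold Rdiv; rewrite Rpow_mult_distr; ring).
    apply Rmult_le_compat_l; [lra|]; apply Rmult_le_compat_r;
      [left; apply weight_pos; lra|].
    apply Rmult_le_compat_l; trivial; lra.
Qed.

Lemma diff_op_leading phi n :
  (d1 <= n)%nat ->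
  diff_op Lambda c phi n =
  (entry c j1 n (n - d1) * phi (n - d1)%nat +
   csum (fun j => csum (fun l => rest j n l * phi l) (seq 0 (S n))) Lambda)%C.
Proof.
  intros Hn.
  rewrite (diff_op_triangular p Lambda c alpha hmax halpha) by exact hm.
  rewrite <- (op_matrix_diag Lambda c alpha halpha n n) by lia.
  rewrite <- (csum_seq_S (fun l => op_matrix Lambda c n l * phi l)%C).
  rewrite (csum_ext _ (fun l => csum (fun j => entry c j n l * phi l)%C Lambda)).
  2: { intros l _; symmetry; apply csum_mult_r. }
  rewrite csum_swap.
  rewrite (csum_ext _ (fun j =>
    csum (fun l => if leading j n l then entry c j n l * phi l else 0)%C (seq 0 (S n)) +
    csum (fun l => rest j n l * phi l) (seq 0 (S n)))%C).
  2: { intros j _; rewrite <- csum_plus; apply csum_ext; intros l _.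
       unfold rest; destruct (leading j n l); ring. }
  rewrite csum_plus; f_equal.
  rewrite (csum_delta _ Lambda j1) by trivial.
  rewrite (csum_0 _ Lambda).
  2: { intros j _; destruct (Nat.eqb_spec j j1) as [|Hne]; trivial.
       apply csum_0; intros l _; unfold leading.
       destruct (Nat.eqb_spec j j1); [contradiction|reflexivity]. }
  rewrite (csum_delta _ (seq 0 (S n)) (n - d1)) by (apply seq_NoDup || apply in_seq; lia).
  rewrite (csum_0 _ (seq 0 (S n))).
  2: { intros l _; unfold leading; destruct (Nat.eqb_spec l (n - d1)); trivial.
       rewrite Bool.andb_false_r; reflexivity. }
  unfold leading; rewrite !Nat.eqb_refl; simpl; ring.
Qed.

(** Row [l + d1] expresses [phi l] through the remaining entries, whose weighted sum is at most half
    the leading one. A bound [M * w] thus improves to [M / 2 * w] for all indices at once, and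
    iteration forces zero. *)
Lemma weighted_uniqueness :
  exists N, (d1 <= N)%nat /\ forall (phi : fps) M,
    (forall l, Cmod (phi l) <= M * w l) ->
    (forall l, (l < N - d1)%nat -> phi l = 0%C) ->
    (forall n, (N <= n)%nat -> diff_op Lambda c phi n = 0%C) ->
    forall l, phi l = 0%C.
Proof.
  destruct leading_entry_dominates as (N & HdN & HN).
  exists N; split; trivial; intros phi M Hphi Hlow Hrow.
  assert (HM : 0 <= M).
  { pose proof (Hphi 0%nat) as H; pose proof (Cmod_ge_0 (phi 0%nat)).
    assert (0 < w 0%nat) by (apply weight_pos; lra).
    destruct (Rle_lt_dec 0 M); trivial; nra. }
  assert (Hhalf : forall k l, Cmod (phi l) <= M * (/ 2) ^ k * w l).
  { induction k as [|k IH]; intros l; [simpl; rewrite Rmult_1_r; apply Hphi|].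
    assert (Hwl : 0 < w l) by (apply weight_pos; lra).
    assert (HMk : 0 <= M * (/ 2) ^ k) by (apply Rmult_le_pos; [|apply pow_le]; lra).
    destruct (le_lt_dec (N - d1) l) as [Hl|Hl].
    2: { rewrite Hlow, Cmod_0 by trivial; simpl; nra. }
    destruct (HN (l + d1)%nat) as [Hpos Hsum]; [lia|].
    pose proof (diff_op_leading phi (l + d1)) as E.
    rewrite Hrow in E by lia; specialize (E ltac:(lia)).
    rewrite Nat.add_sub in *.
    set (e := entry c j1 (l + d1) l) in *; set (r := csum _ _) in E.
    apply Rmult_le_reg_l with (Cmod e); trivial; rewrite <- Cmod_mult.
    replace (e * phi l)%C with (- r)%C.
    2: { transitivity (e * phi l + r - r)%C; [rewrite <- E|]; ring. }
    rewrite Cmod_opp.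
    apply Rle_trans with (M * (/ 2) ^ k *
      rsum (fun j => rsum (fun l0 => Cmod (rest j (l + d1) l0) * w l0)
                       (seq 0 (S (l + d1)))) Lambda).
    - unfold r; eapply Rle_trans; [apply Cmod_csum_le|].
      rewrite <- rsum_mult_l; apply rsum_le; intros j _.
      eapply Rle_trans; [apply Cmod_csum_le|].
      rewrite <- rsum_mult_l; apply rsum_le; intros i _.
      rewrite Cmod_mult.
      replace (M * (/ 2) ^ k * (Cmod (rest j (l + d1) i) * w i))
        with (Cmod (rest j (l + d1) i) * (M * (/ 2) ^ k * w i)) by ring.
      apply Rmult_le_compat_l; [apply Cmod_ge_0 | apply IH].
    - eapply Rle_trans; [apply Rmult_le_compat_l; [exact HMk | exact Hsum]|].
      simpl; right; ring. }
  intros l; apply Cmod_eq_0; apply Rle_antisym; [|apply Cmod_ge_0].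
  apply Rnot_lt_le; intros Hlt.
  assert (Hwl : 0 < w l) by (apply weight_pos; lra).
  assert (HMw : 0 < M * w l + 1) by nra.
  destruct (pow_lt_1_zero (/ 2)) with (y := Cmod (phi l) / (M * w l + 1)) as [k Hk].
  { rewrite Rabs_pos_eq; lra. }
  { now apply Rdiv_lt_0_compat. }
  specialize (Hk k (le_n k)); rewrite Rabs_pos_eq in Hk by (apply pow_le; lra).
  apply Rmult_lt_compat_r with (r := M * w l + 1) in Hk; trivial.
  replace (Cmod (phi l) / (M * w l + 1) * (M * w l + 1)) with (Cmod (phi l)) in Hk
    by (field; lra).
  specialize (Hhalf k l).
  assert (0 < (/ 2) ^ k) by (apply pow_lt; lra).
  lra.
Qed.

End Dominant.

Lemma monomial_fact_gevrey s i :
  0 <= s -> fact_gevrey s (fun n => if (n =? i)%nat then 1%C else 0%C).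
Proof.
  intros Hs; exists 1, 1; repeat split; try lra; intros n; rewrite pow1.
  assert (H : 1 <= fact_power s n).
  { replace 1 with (fact_power s 0); [apply fact_power_le; trivial; lia|].
    unfold fact_power, Rpower; simpl; rewrite ln_1, Rmult_0_r; apply exp_0. }
  destruct (n =? i)%nat; [rewrite Cmod_1|rewrite Cmod_0]; lra.
Qed.

(* With [N] and [d1 >= 1] as in [weighted_uniqueness], the solutions of
   [P f = z^i], [i < N], have a nontrivial combination whose first [N - d1]
   coefficients vanish, hence which is zero. *)
Lemma slope_condition_of_surjective s J :
  0 <= s -> In J Lambda -> alpha J = J ->
  (forall j, In j Lambda -> alpha j = j -> (j <= J)%nat) ->
  (forall g, fact_gevrey s g -> exists f, fact_gevrey s f /\ diff_op Lambda c f = g) ->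
  forall j, In j Lambda -> INR j - INR J <= s * (INR (alpha j) - INR j).
Proof.
  intros Hs HJ HJ0 HJmax Hsurj j Hj; apply Rnot_lt_le; intros Hbad.
  set (d := fun j => (alpha j - j)%nat).
  assert (Hd : forall i, In i Lambda -> INR (d i) = INR (alpha i) - INR i).
  { intros i Hi; unfold d; apply minus_INR, order_ge, Hi. }
  rewrite <- Hd in Hbad by trivial.
  destruct (dominant_exponent d s Lambda) as (j1 & e0 & Hj1 & He0 & Hdom).
  { intros E; rewrite E in Hj; destruct Hj. }
  set (gap := INR j - INR J - s * INR (d j)).
  (* Below [e0], so that [j1] is the unique maximum at [t = s + e], and so small that
     [j - t * d j > J] persists. *)
  set (e := Rmin (e0 / 2) (gap / (INR (d j) + 1) / 2)).
  pose proof (pos_INR (d j)) as Hdj.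
  assert (Hgap : 0 < gap) by (unfold gap; lra).
  assert (Hq : 0 < gap / (INR (d j) + 1)) by (apply Rdiv_lt_0_compat; lra).
  assert (He : 0 < e < e0 /\ e * (INR (d j) + 1) < gap).
  { pose proof (Rmin_l (e0 / 2) (gap / (INR (d j) + 1) / 2)).
    pose proof (Rmin_r (e0 / 2) (gap / (INR (d j) + 1) / 2)).
    assert (0 < e) by (apply Rmin_glb_lt; lra).
    split; [unfold e in *; lra|].
    apply Rlt_le_trans with (gap / (INR (d j) + 1) * (INR (d j) + 1)).
    - apply Rmult_lt_compat_r; [lra | unfold e; lra].
    - right; field; lra. }
  destruct He as [He Hegap]; specialize (Hdom e He).
  set (t := s + e) in *.
  (* If [d j1 = 0], then [j1 <= J < j - t * d j], against the maximality of [j1]. *)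
  assert (Hd1 : (1 <= d j1)%nat).
  { destruct (Nat.eq_dec (d j1) 0) as [E|E]; [exfalso|lia].
    assert (Hle : INR j - t * INR (d j) <= INR j1 - t * INR (d j1)).
    { destruct (Nat.eq_dec j j1) as [->|Hne]; [lra | left; now apply Hdom]. }
    assert (HjJ : (j1 <= J)%nat).
    { apply HJmax; trivial; pose proof (order_ge j1 Hj1); unfold d in E; lia. }
    apply le_INR in HjJ; rewrite E in Hle; simpl in Hle; unfold t, gap in *; lra. }
  assert (Ht : 0 < t) by (unfold t; lra).
  destruct (weighted_uniqueness t j1 Ht Hj1 Hdom) as (N & HdN & HN).
  fold (d j1) in HdN, HN.
  assert (Hex : forall i, exists f, fact_gevrey s f /\
    diff_op Lambda c f = (fun n => if (n =? i)%nat then 1%C else 0%C)).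
  { intros i; apply Hsurj, monomial_fact_gevrey, Hs. }
  set (F := fun i => proj1_sig (constructive_indefinite_description _ (Hex i))).
  assert (HF : forall i, fact_gevrey s (F i) /\
    diff_op Lambda c (F i) = (fun n => if (n =? i)%nat then 1%C else 0%C))
    by (intros i; exact (proj2_sig (constructive_indefinite_description _ (Hex i)))).
  destruct (underdetermined_system
    (map (fun l i => F i l) (seq 0 (N - d j1))) N) as (x & (k & Hk & Hxk) & Hx).
  { rewrite length_map, length_seq; lia. }
  set (phi := fun n => csum (fun i => F i n * x i)%C (seq 0 N)).
  assert (HP : forall n, diff_op Lambda c phi n =
    csum (fun i => (if (n =? i)%nat then 1 else 0) * x i)%C (seq 0 N)).
  { intros n; rewrite (diff_op_matrix _ _ _ p) by trivial; unfold phi.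
    rewrite (csum_ext _ (fun l => csum (fun i =>
      (op_matrix Lambda c n l * F i l) * x i)%C (seq 0 N)) (seq 0 (S (n + p)))).
    2: { intros l _; rewrite <- csum_mult_l; apply csum_ext; intros; ring. }
    rewrite csum_swap; apply csum_ext; intros i _; rewrite csum_mult_r.
    rewrite <- (diff_op_matrix Lambda c (F i) p n hmax), (proj2 (HF i)); reflexivity. }
  assert (Hbound : exists M, forall l, Cmod (phi l) <= M * weight (2 * B) t l).
  { unfold phi; generalize (seq 0 N) as L; induction L as [|i L [M HM]].
    - exists 0; intros l; unfold csum; simpl; rewrite Cmod_0; lra.
    - destruct (fact_gevrey_weight_bound s t (2 * B) (F i)) as [M1 HM1];
        [unfold t; lra|lra|apply HF|].
      exists (M1 * Cmod (x i) + M); intros l; rewrite csum_cons.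
      eapply Rle_trans; [apply Cmod_triangle|]; rewrite Cmod_mult.
      specialize (HM l); specialize (HM1 l).
      apply Rmult_le_compat_r with (r := Cmod (x i)) in HM1; [|apply Cmod_ge_0].
      lra. }
  destruct Hbound as [M HM].
  assert (Hphi : forall l, phi l = 0%C).
  { apply (HN phi M HM).
    - intros l Hl; apply (Hx (fun i => F i l)).
      apply (in_map (fun l i => F i l)), in_seq; lia.
    - intros n Hn; rewrite HP; apply csum_0; intros i Hi; apply in_seq in Hi.
      destruct (Nat.eqb_spec n i); [lia|ring]. }
  (* The operator sends [phi] to the polynomial with coefficients [x], so [phi = 0] makes its [k]-th
     coefficient [x k] vanish. *)
  apply Hxk.
  pose proof (HP k) as E.
  rewrite (functional_extensionality phi (fun _ => 0%C) Hphi) in E.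
  rewrite (diff_op_0 _ _ p) in E by trivial.
  rewrite (csum_delta _ (seq 0 N) k), csum_0 in E by
    (apply seq_NoDup || (apply in_seq; lia) ||
     (intros i _; rewrite Nat.eqb_sym; destruct (k =? i)%nat; trivial; ring)).
  rewrite Nat.eqb_refl in E; transitivity (1 * x k + 0)%C; [ring | now symmetry].
Qed.

End SlopeNecessity.

Theorem theorem2 (s : R) (hs : 0 <= s)
  (* Lambda has no repetition and p is its largest element *)
  (p : nat) (hp : (1 <= p)%nat)
  (Lambda : list nat) (hLambda : NoDup Lambda)
  (hpLambda : In p Lambda) (hmax : forall j, In j Lambda -> (j <= p)%nat)
  (D : C -> Prop) (hDopen : open D) (hD0 : D (RtoC 0))
  (a : nat -> C -> C)
  (ha : forall j, In j Lambda -> holomorphic_on D (a j))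
  (* c j k is the k-th Taylor coefficient of a j at 0 *)
  (c : nat -> fps)
  (hc : forall j, In j Lambda -> is_taylor_at_0 (a j) (c j))
  (* a j is nonzero, with a zero of order alpha j at 0 *)
  (alpha : nat -> nat)
  (halpha : forall j, In j Lambda -> is_order (c j) (alpha j)) :
  (linear_automorphism_on (fun _ => True) (diff_op Lambda c) /\
   linear_automorphism_on (gevrey s) (diff_op Lambda c))
  <->
  (lower_ordinate Lambda alpha = 0%Z /\
   (forall n : nat,
      char_poly Lambda c alpha (lower_ordinate Lambda alpha)
        (RtoC (INR n)) <> RtoC 0) /\
   Rbar_le (inv_Rbar s)
     (first_positive_slope (newton_polygon Lambda alpha))).
Proof.
  rewrite (formal_automorphism_iff p Lambda c alpha) by trivial.
  destruct (uniform_taylor_bound Lambda a c hc) as (K & B & hK & hB & hKB).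
  assert (HJ : lower_ordinate Lambda alpha = 0%Z -> exists J,
    In J Lambda /\ alpha J = J /\
    forall j, In j Lambda -> alpha j = j -> (j <= J)%nat).
  { intros Hm.
    destruct (bounded_nat_max (fun j => In j Lambda /\ alpha j = j) p)
      as (J & [HJ HJ0] & HJmax).
    - destruct (lower_ordinate_attained Lambda alpha p hpLambda) as (j & Hj & E).
      exists j; split; trivial; rewrite Hm in E; unfold ordinate in E; lia.
    - intros j [Hj _]; now apply hmax.
    - exists J; repeat split; trivial; intros j H1 H2; now apply HJmax. }
  assert (Hslope : forall J, lower_ordinate Lambda alpha = 0%Z ->
    In J Lambda -> alpha J = J ->
    (forall j, In j Lambda -> alpha j = j -> (j <= J)%nat) ->
    (Rbar_le (inv_Rbar s) (first_positive_slope (newton_polygon Lambda alpha)) <->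
     forall j, In j Lambda -> INR j - INR J <= s * (INR (alpha j) - INR j))).
  { intros J Hm H1 H2 H3; apply first_positive_slope_ge_iff; trivial.
    intros j Hj; now apply (order_ge Lambda alpha). }
  split.
  - intros [[Hm HW] (_ & _ & _ & _ & Hsurj)]; split; [trivial|]; split; [trivial|].
    destruct (HJ Hm) as (J & HJ1 & HJ2 & HJ3).
    apply (Hslope J); trivial.
    apply (slope_condition_of_surjective p Lambda c alpha K B); trivial.
    intros g Hg; destruct (Hsurj g) as (f & Hf & E);
      [now apply gevrey_iff_fact_gevrey|].
    exists f; split; trivial; now apply gevrey_iff_fact_gevrey.
  - intros (Hm & HW & Hc); split; [tauto|].
    destruct (HJ Hm) as (J & HJ1 & HJ2 & HJ3).
    pose proof (proj1 (Hslope J Hm HJ1 HJ2 HJ3) Hc) as Hc'.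
    split; [|split; [|split; [|split]]].
    + intros f Hf; apply gevrey_iff_fact_gevrey; trivial.
      apply (diff_op_fact_gevrey p Lambda c alpha K B); trivial.
      now apply gevrey_iff_fact_gevrey.
    + intros; now apply (diff_op_add _ _ p).
    + intros; now apply (diff_op_scal _ _ p).
    + intros f g _ _; now apply (diff_op_injective p Lambda c alpha).
    (* A regularity statement: the formal preimage already exists, and only its growth remains to be
       estimated. *)
    + intros g Hg.
      destruct (diff_op_surjective p Lambda c alpha hmax halpha Hm HW g) as [f Hf].
      exists f; split; trivial; apply gevrey_iff_fact_gevrey; trivial.
      apply (fact_gevrey_of_diff_op p Lambda c alpha K B hLambda hmax halpha Hm
               hK hB hKB s J); trivial.
      rewrite Hf; now apply gevrey_iff_fact_gevrey.
Qed.
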